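(* Let $T$ be a compact abelian group, $H$ a Hopf $*$-algebra, $\pi\colon H\to\mathbb{C}[T]$ a Hopf $*$-algebra map, and $\beta\colon\hat T\times\hat T\to\mathbb{T}$ a bicharacter. Then, for every $H$-cocentral closed subgroup $T_0\subset T$, the transmutation $H_\beta$ can be viewed as an object of $\mathrm{Hopf}^*(\mathbb{C}[T/T_0],i^*\beta)$, where $i\colon\mathbb{C}[T/T_0]\to\mathbb{C}[T]$ is the embedding map and $i^*\beta=\beta\circ(i\otimes i)$. That is, the coaction $\mathrm{ad}_\pi$ takes values in $H\otimes\mathbb{C}[T/T_0]$, and with this coaction of $\mathbb{C}[T/T_0]$ the structure maps of $H_\beta$ make it a braided Hopf $*$-algebra over $(\mathbb{C}[T/T_0],i^*\beta)$.
   Context: Algebras are unital over $\mathbb{C}$; $\mathbb{T}$ is the unit circle. For a compact abelian group $T$, $\mathbb{C}[T]=\mathbb{C}\hat T$ is the group Hopf $*$-algebra of $\hat T$ (basis $a\in\hat T$, $\Delta(a)=a\otimes a$, $\varepsilon(a)=1$, $S(a)=a^{-1}=a^*$). A bicharacter is a map multiplicative in each variable, extended bilinearly to $\mathbb{C}[T]\otimes\mathbb{C}[T]$. Braided Hopf $*$-algebras: a right $\mathbb{C}[T]$-comodule $*$-algebra is a $*$-algebra $A$ with a coaction $\delta_A\colon A\to A\otimes\mathbb{C}[T]$, $\delta_A(x)=x^{(1)}\otimes x^{(2)}$, that is a $*$-homomorphism. For two such algebras $A,B$, $A\otimes_\beta B$ is the $*$-algebra with underlying space $A\otimes B$, product $(x\otimes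 y)(x'\otimes y')=\beta(y^{(2)},x'^{(2)})\,xx'^{(1)}\otimes y^{(1)}y'$, involution $(x\otimes y)^*=\beta(y^{(2)*},x^{(2)*})\,x^{(1)*}\otimes y^{(1)*}$, and the tensor product coaction. An object of $\mathrm{Hopf}^*(\mathbb{C}[T],\beta)$ (a braided Hopf $*$-algebra over $(\mathbb{C}[T],\beta)$) is a $\mathbb{C}[T]$-comodule $*$-algebra $A$ with comodule maps $\Delta_A\colon A\to A\otimes_\beta A$ and $\varepsilon_A\colon A\to\mathbb{C}$ (unital $*$-homomorphisms) and $S_A\colon A\to A$ satisfying the usual coassociativity, counit and antipode identities. Bi-grading: $H=\bigoplus_{a,b\in\hat T}H_{a,b}$, $H_{a,b}=\{x:(\pi\otimes\iota)\Delta(x)=a\otimes x,\ (\iota\otimes\pi)\Delta(x)=x\otimes b\}$. The coaction $\mathrm{ad}_\pi(x)=x_{(2)}\otimes\pi(S(x_{(1)})x_{(3)})$ satisfies $\mathrm{ad}_\pi(x)=x\otimes a^{-1}b$ for $x\in H_{a,b}$. Transmutation $H_\beta\in\mathrm{Hopf}^*(\mathbb{C}[T],\beta)$: the coalgebra $H$ (same coproduct and counit) with coaction $\mathrm{ad}_\pi$ and, for $x\in H_{a,b}$, $y\in H_{c,d}$, $x\cdot_\beta y=\beta(a^{-1}b,c^{-1})xy$, $S_\beta(x)=\beta(a^{-1}b,b)S(x)$, $x^{*_\beta}=\beta(a^{-1}b,a^{-1})x^*$. A closed subgroup $T_0\subset T$ is $H$-cocentral if $H_{a,b}=0$ whenever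 $a|_{T_0}\ne b|_{T_0}$. $\mathbb{C}[T/T_0]\subset\mathbb{C}[T]$ is the span of the $a\in\hat T$ with $a|_{T_0}=1$. *)

(* Defs.v *)
From HB Require Import structures.
From mathcomp Require Import all_boot all_order all_algebra.
From mathcomp Require Import all_classical all_reals all_analysis.
From mathcomp Require Import finmap complex.
From mathcomp Require Import -(notations) monalg.

Set Implicit Arguments.
Unset Strict Implicit.
Unset Printing Implicit Defensive.

Import Order.TTheory GRing.Theory Num.Theory.
Import numFieldNormedType.Exports.

Local Open Scope classical_set_scope.
Local Open Scope quotient_scope.
Local Open Scope ring_scope.

(** * Tensor products *)

(* [U ⊗ V] is the type of formal sums of pairs (u, v), two sums being
   identified when every bilinear map into every K-module takes the same value
   on them; [tlift] is the resulting universal property (see [tlift_tpure],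
   [tlift_linear] and [tens_ext]). *)
Notation bilin := (bilinear_for *:%R *:%R).

Section Tensor.
Variables (K : fieldType) (U V : lmodType K).

Definition tsum (W : zmodType) (f : U -> V -> W) (s : seq (U * V)) : W :=
  \sum_(p <- s) f p.1 p.2.

Definition tens_rel : rel (seq (U * V)) := fun s s' =>
  `[< forall (W : lmodType K) (f : U -> V -> W),
        bilin f -> tsum f s = tsum f s' >].

Lemma tens_rel_refl : reflexive tens_rel.
Proof. by move=> s; apply/asboolP. Qed.

Lemma tens_rel_sym : symmetric tens_rel.
Proof.
by move=> s s'; apply/asboolP/asboolP => H W f bf; rewrite (H W f bf).
Qed.

Lemma tens_rel_trans : transitive tens_rel.
Proof.
move=> s s' s'' /asboolP H1 /asboolP H2; apply/asboolP => W f bf.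
by rewrite (H1 W f bf) (H2 W f bf).
Qed.

Canonical tens_equiv :=
  EquivRel tens_rel tens_rel_refl tens_rel_sym tens_rel_trans.

Definition tens := {eq_quot tens_equiv}.
HB.instance Definition _ := Choice.on tens.

Definition tens_of (s : seq (U * V)) : tens := \pi s.

Definition tpure (u : U) (v : V) : tens := tens_of [:: (u, v)].

Definition tlift (W : zmodType) (f : U -> V -> W) (t : tens) : W :=
  tsum f (repr t).

Lemma tlift_of (W : lmodType K) (f : U -> V -> W) s :
  bilin f -> tlift f (tens_of s) = tsum f s.
Proof.
move=> bf; rewrite /tlift.
have /eqmodP/asboolP/(_ W f bf) // : repr (tens_of s) = s %[mod tens].
by rewrite reprK.
Qed.

Lemma tens_ext (t t' : tens) :
  (forall (W : lmodType K) (f : U -> V -> W), bilin f ->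
     tlift f t = tlift f t') -> t = t'.
Proof.
move=> H; rewrite -[t]reprK -[t']reprK; apply/eqmodP/asboolP => W f bf.
exact: H.
Qed.

Definition tens_add (t t' : tens) : tens := tens_of (repr t ++ repr t').
Definition tens_scale (a : K) (t : tens) : tens :=
  tens_of [seq (a *: p.1, p.2) | p <- repr t].
Definition tens_zero : tens := tens_of [::].
Definition tens_opp (t : tens) : tens := tens_scale (-1) t.

Section Lift.
Variables (W : lmodType K) (f : U -> V -> W).
Hypothesis bf : bilin f.

Lemma tlift_add t t' : tlift f (tens_add t t') = tlift f t + tlift f t'.
Proof. by rewrite tlift_of // /tsum big_cat. Qed.

Lemma tlift_scale a t : tlift f (tens_scale a t) = a *: tlift f t.
Proof.
rewrite tlift_of // /tsum big_map scaler_sumr; apply: eq_bigr => p _ /=.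
exact: (scalable_linear (bf.1 p.2)).
Qed.

Lemma tlift_zero : tlift f tens_zero = 0.
Proof. by rewrite tlift_of // /tsum big_nil. Qed.

Lemma tlift_opp t : tlift f (tens_opp t) = - tlift f t.
Proof. by rewrite tlift_scale scaleN1r. Qed.
End Lift.

Lemma tens_addA : associative tens_add.
Proof. by move=> x y z; apply: tens_ext => W f bf; rewrite !tlift_add // addrA. Qed.

Lemma tens_addC : commutative tens_add.
Proof. by move=> x y; apply: tens_ext => W f bf; rewrite !tlift_add // addrC. Qed.

Lemma tens_add0 : left_id tens_zero tens_add.
Proof.
by move=> x; apply: tens_ext => W f bf; rewrite tlift_add // tlift_zero // add0r.
Qed.

Lemma tens_addN : left_inverse tens_zero tens_opp tens_add.
Proof.
move=> x; apply: tens_ext => W f bf.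
by rewrite tlift_add // tlift_zero // tlift_opp // addNr.
Qed.

HB.instance Definition _ :=
  GRing.isZmodule.Build tens tens_addA tens_addC tens_add0 tens_addN.

Lemma tens_scaleA a b t : tens_scale a (tens_scale b t) = tens_scale (a * b) t.
Proof. by apply: tens_ext => W f bf; rewrite !tlift_scale // scalerA. Qed.

Lemma tens_scale1 : left_id 1 tens_scale.
Proof. by move=> t; apply: tens_ext => W f bf; rewrite tlift_scale // scale1r. Qed.

Lemma tens_scaleDr : right_distributive tens_scale +%R.
Proof.
move=> a t t'; apply: tens_ext => W f bf.
by rewrite !(tlift_scale, tlift_add) // scalerDr.
Qed.

Lemma tens_scaleDl t : {morph tens_scale^~ t : a b / a + b}.
Proof.
move=> a b; apply: tens_ext => W f bf.
by rewrite !(tlift_scale, tlift_add) // scalerDl.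
Qed.

HB.instance Definition _ := GRing.Zmodule_isLmodule.Build K tens
  tens_scaleA tens_scale1 tens_scaleDr tens_scaleDl.

Lemma tlift_linear (W : lmodType K) (f : U -> V -> W) :
  bilin f -> linear (tlift f).
Proof. by move=> bf a t t'; rewrite tlift_add // tlift_scale. Qed.

Lemma tlift_tpure (W : lmodType K) (f : U -> V -> W) u v :
  bilin f -> tlift f (tpure u v) = f u v.
Proof. by move=> bf; rewrite tlift_of // /tsum big_seq1. Qed.

Lemma tpure_bilin : bilin tpure.
Proof.
split=> [v a u u'|u a v v'] /=; apply: tens_ext => W f bf.
- by rewrite (tlift_linear bf) !tlift_tpure //; exact: (bf.1 v).
- by rewrite (tlift_linear bf) !tlift_tpure //; exact: (bf.2 u).
Qed.

Lemma tpure_linl a u u' v :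
  tpure (a *: u + u') v = a *: tpure u v + tpure u' v.
Proof. exact: (tpure_bilin.1 v). Qed.

Lemma tpure_linr a u v v' :
  tpure u (a *: v + v') = a *: tpure u v + tpure u v'.
Proof. exact: (tpure_bilin.2 u). Qed.

Lemma tens_sum (t : tens) : t = \sum_(p <- repr t) tpure p.1 p.2.
Proof.
apply: tens_ext => W f bf; pose g : tens -> W := tlift f.
have gl : linear g := tlift_linear bf.
pose G : {linear tens -> W} := HB.pack g (GRing.isLinear.Build _ _ _ _ _ gl).
rewrite -[tlift f (\sum_(p <- repr t) _)]/(G _) raddf_sum.
by apply: eq_bigr => p _; rewrite /G /g /= tlift_tpure.
Qed.

End Tensor.

Arguments tens_rel : simpl never.

Notation "U ⊗ V" := (tens U%type V%type) (at level 40, left associativity) : type_scope.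
Notation "u ⊗ v" := (tpure u v) (at level 40, left associativity) : ring_scope.

Section TensorMaps.
Variable K : fieldType.

Definition tmap (U V U' V' : lmodType K) (f : U -> U') (g : V -> V') :
    U ⊗ V -> U' ⊗ V' :=
  tlift (fun u v => f u ⊗ g v).

Definition tassoc (U V W : lmodType K) : (U ⊗ V) ⊗ W -> U ⊗ (V ⊗ W) :=
  tlift (fun t w => tlift (fun u v => u ⊗ (v ⊗ w)) t).

Definition tmul (U V : lmodType K) (mulU : U -> U -> U) (mulV : V -> V -> V)
    (s t : U ⊗ V) : U ⊗ V :=
  tlift (fun u v => tlift (fun u' v' => mulU u u' ⊗ mulV v v') t) s.

End TensorMaps.

(** * Antilinear maps *)

Definition antilinear (C : numClosedFieldType) (U W : lmodType C) (f : U -> W) :=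
  forall a x y, f (a *: x + y) = a^* *: f x + f y.

(* The conjugate module: antilinear maps into W are linear maps into [cmod W],
   so that [tlift] can also be applied to biantilinear maps. *)
Section ConjugateModule.
Variables (C : numClosedFieldType) (W : lmodType C).

Definition cmod : Type := W.
HB.instance Definition _ := GRing.Zmodule.on cmod.

Definition cscale (a : C) (w : cmod) : cmod := a^* *: (w : W).

Lemma cscaleA a b w : cscale a (cscale b w) = cscale (a * b) w.
Proof. by rewrite /cscale scalerA rmorphM. Qed.
Lemma cscale1 : left_id 1 cscale.
Proof. by move=> w; rewrite /cscale conjC1 scale1r. Qed.
Lemma cscaleDr : right_distributive cscale +%R.
Proof. by move=> a u v; rewrite /cscale scalerDr. Qed.
Lemma cscaleDl w : {morph cscale^~ w : a b / a + b}.
Proof. by move=> a b; rewrite /cscale rmorphD scalerDl. Qed.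

HB.instance Definition _ := GRing.Zmodule_isLmodule.Build C cmod
  cscaleA cscale1 cscaleDr cscaleDl.

Lemma cmodE (a : C) (w : cmod) : a *: w = a^* *: (w : W) :> W.
Proof. by []. Qed.

End ConjugateModule.

Section TensorMapsTheory.
Variable K : fieldType.
Implicit Types U V W : lmodType K.

Lemma lin0 U V (f : U -> V) : linear f -> f 0 = 0.
Proof. by move=> lf; have /= := scalable_linear lf 0 0; rewrite !scale0r. Qed.
Lemma linZ U V (f : U -> V) : linear f -> forall a u, f (a *: u) = a *: f u.
Proof. by move=> lf; exact: scalable_linear lf. Qed.
Lemma linD U V (f : U -> V) : linear f -> {morph f : u v / u + v}.
Proof. by move=> lf u v; have := lf 1 u v; rewrite !scale1r. Qed.
Lemma lin_sum U V (f : U -> V) (lf : linear f) I (r : seq I) (F : I -> U) :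
  f (\sum_(i <- r) F i) = \sum_(i <- r) f (F i).
Proof. exact: (big_morph f (linD lf) (lin0 lf)). Qed.

Lemma lin_comp U V W (f : V -> W) (g : U -> V) :
  linear f -> linear g -> linear (fun u => f (g u)).
Proof. by move=> lf lg a x y; rewrite lg lf. Qed.

Lemma eq_tlift (U V : lmodType K) (W : zmodType) (f g : U -> V -> W) :
  f =2 g -> tlift f =1 tlift g.
Proof. by move=> fg t; rewrite /tlift /tsum; apply: eq_bigr => p _; exact: fg. Qed.

Lemma tlift_D (U V : lmodType K) (W : zmodType) (f g : U -> V -> W) t :
  tlift (fun u v => f u v + g u v) t = tlift f t + tlift g t.
Proof. by rewrite /tlift /tsum big_split. Qed.

Lemma tlift_Z (U V W : lmodType K) (f : U -> V -> W) a t :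
  tlift (fun u v => a *: f u v) t = a *: tlift f t.
Proof. by rewrite /tlift /tsum scaler_sumr. Qed.

Lemma tens_lin_ext U V W (f g : U ⊗ V -> W) : linear f -> linear g ->
  (forall u v, f (u ⊗ v) = g (u ⊗ v)) -> f =1 g.
Proof.
move=> lf lg fg t; rewrite [t]tens_sum !lin_sum //.
by apply: eq_bigr => p _; exact: fg.
Qed.

Lemma bilin_tmap U V U' V' (f : U -> U') (g : V -> V') :
  linear f -> linear g -> bilin (fun u v => f u ⊗ g v).
Proof.
move=> lf lg; split=> [v a u u'|u a v v'] /=.
  by rewrite lf; exact: tpure_linl.
by rewrite lg; exact: tpure_linr.
Qed.

Lemma tmap_linear U V U' V' (f : U -> U') (g : V -> V') :
  linear f -> linear g -> linear (tmap f g).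
Proof. by move=> lf lg; apply: tlift_linear; exact: bilin_tmap. Qed.

Lemma tmap_tpure U V U' V' (f : U -> U') (g : V -> V') u v :
  linear f -> linear g -> tmap f g (u ⊗ v) = f u ⊗ g v.
Proof. by move=> lf lg; rewrite /tmap tlift_tpure //; exact: bilin_tmap. Qed.

Lemma bilin_tassoc1 U V W (w : W) :
  bilin (fun (u : U) (v : V) => u ⊗ (v ⊗ w)).
Proof.
split=> [v a u u'|u a v v'] /=; first exact: tpure_linl.
rewrite tpure_linl.
exact: tpure_linr.
Qed.

Lemma bilin_tassoc U V W :
  bilin (fun (t : U ⊗ V) (w : W) => tlift (fun u v => u ⊗ (v ⊗ w)) t).
Proof.
split=> [w|t a w w'] /=; first by apply: tlift_linear; exact: bilin_tassoc1.
rewrite -tlift_Z -tlift_D; apply: eq_tlift => u v.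
rewrite tpure_linr.
exact: tpure_linr.
Qed.

Lemma tassoc_linear U V W : linear (@tassoc K U V W).
Proof. by apply: tlift_linear; exact: bilin_tassoc. Qed.

Lemma tassoc_tpure U V W (u : U) (v : V) (w : W) :
  tassoc ((u ⊗ v) ⊗ w) = u ⊗ (v ⊗ w).
Proof.
rewrite /tassoc tlift_tpure; last exact: bilin_tassoc.
by rewrite tlift_tpure //; exact: bilin_tassoc1.
Qed.

Section Tmul.
Variables (U V : lmodType K) (mulU : U -> U -> U) (mulV : V -> V -> V).
Hypotheses (bU : bilin mulU) (bV : bilin mulV).

Lemma bilin_tmul1 u v : bilin (fun u' v' => mulU u u' ⊗ mulV v v').
Proof. by apply: bilin_tmap; [exact: bU.2|exact: bV.2]. Qed.

Lemma bilin_tmul2 t :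
  bilin (fun u v => tlift (fun u' v' => mulU u u' ⊗ mulV v v') t).
Proof.
split=> [v a u1 u2|u a v1 v2] /=; rewrite -tlift_Z -tlift_D;
  apply: eq_tlift => u' v'.
- have /= -> := bU.1 u' a u1 u2; exact: tpure_linl.
- have /= -> := bV.1 v' a v1 v2; exact: tpure_linr.
Qed.

Lemma tmul_bilin : bilin (tmul mulU mulV).
Proof.
split=> [t|s a t t'] /=; first by apply: tlift_linear; exact: bilin_tmul2.
rewrite /tmul -tlift_Z -tlift_D; apply: eq_tlift => u v.
by rewrite (tlift_linear (bilin_tmul1 u v)).
Qed.

Lemma tmul_tpure u v u' v' :
  tmul mulU mulV (u ⊗ v) (u' ⊗ v') = mulU u u' ⊗ mulV v v'.
Proof.
rewrite /tmul tlift_tpure; last exact: bilin_tmul2.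
by rewrite tlift_tpure //; exact: bilin_tmul1.
Qed.
End Tmul.

End TensorMapsTheory.

Section TensorStar.
Variable C : numClosedFieldType.

Definition tstar (U V : lmodType C) (starU : U -> U) (starV : V -> V) :
    U ⊗ V -> U ⊗ V :=
  tlift (fun u v => starU u ⊗ starV v).

Variables (U V : lmodType C) (starU : U -> U) (starV : V -> V).
Hypotheses (aU : antilinear starU) (aV : antilinear starV).

Lemma bilin_tstar :
  bilin (fun u v => (starU u ⊗ starV v : cmod (U ⊗ V)%type)).
Proof.
split=> [v a u u'|u a v v'] /=; rewrite cmodE.
  by rewrite aU; exact: tpure_linl.
by rewrite aV; exact: tpure_linr.
Qed.

Lemma tstar_antilinear : antilinear (tstar starU starV).
Proof.
move=> a t t'; rewrite /tstar.
exact: (@tlift_linear _ _ _ (cmod (U ⊗ V)%type) _ bilin_tstar).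
Qed.

Lemma tstar_tpure u v : tstar starU starV (u ⊗ v) = starU u ⊗ starV v.
Proof. exact: (@tlift_tpure _ _ _ (cmod (U ⊗ V)%type) _ _ _ bilin_tstar). Qed.

End TensorStar.

(** * Hopf ∗-algebras *)

Section HopfAxioms.
Variables (C : numClosedFieldType) (A : lmodType C).

Record is_algebra (one : A) (mul : A -> A -> A) : Prop := IsAlgebra {
  alg_bilin : bilin mul;
  alg_assoc : associative mul;
  alg_1l : left_id one mul;
  alg_1r : right_id one mul }.

Record is_involution (mul : A -> A -> A) (star : A -> A) : Prop :=
  IsInvolution {
  star_antilinear : antilinear star;
  starK : involutive star;
  starM : forall x y, star (mul x y) = mul (star y) (star x) }.

Record is_coalgebra (comul : A -> A ⊗ A) (counit : A -> C) : Prop :=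
  IsCoalgebra {
  comul_linear : linear comul;
  counit_linear : linear (counit : A -> C^o);
  coassoc : forall x,
    tassoc (tmap comul id (comul x)) = tmap id comul (comul x);
  counitl : forall x, tlift (fun y z => counit y *: z) (comul x) = x;
  counitr : forall x, tlift (fun y z => counit z *: y) (comul x) = x }.

Record is_antipode (one : A) (mul : A -> A -> A) (comul : A -> A ⊗ A)
    (counit : A -> C) (S : A -> A) : Prop := IsAntipode {
  antip_linear : linear S;
  antipl : forall x, tlift (fun y z => mul (S y) z) (comul x) = counit x *: one;
  antipr : forall x, tlift (fun y z => mul y (S z)) (comul x) = counit x *: one }.

End HopfAxioms.

Record hopfStarAlg (C : numClosedFieldType) := HopfStarAlg {
  hcar :> algType C;
  hstar : hcar -> hcar;
  hcomul : hcar -> hcar ⊗ hcar;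
  hcounit : hcar -> C;
  hantip : hcar -> hcar;
  hopf_star : is_involution *%R hstar;
  hopf_coalg : is_coalgebra hcomul hcounit;
  hcomul1 : hcomul 1 = 1 ⊗ 1;
  hcomulM : forall x y, hcomul (x * y) = tmul *%R *%R (hcomul x) (hcomul y);
  hcomul_star : forall x, hcomul (hstar x) = tstar hstar hstar (hcomul x);
  hcounit1 : hcounit 1 = 1;
  hcounitM : forall x y, hcounit (x * y) = hcounit x * hcounit y;
  hcounit_star : forall x, hcounit (hstar x) = (hcounit x)^*;
  hopf_antip : is_antipode 1 *%R hcomul hcounit hantip }.

Record hopfStarMap (C : numClosedFieldType) (H K : hopfStarAlg C) :=
  HopfStarMap {
  hmap :> {lrmorphism H -> K};
  hmap_star : forall x, hmap (hstar x) = hstar (hmap x);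
  hmap_comul : forall x, hcomul (hmap x) = tmap hmap hmap (hcomul x);
  hmap_counit : forall x, hcounit (hmap x) = hcounit x;
  hmap_antip : forall x, hmap (hantip x) = hantip (hmap x) }.

(** * Group algebras *)

(* Abelian groups, including T and its dual, are written additively: a^{-1} b reads
   b - a. [galg C Γ] is the group algebra C[Γ]. *)
Definition galg (C : numClosedFieldType) (Γ : zmodType) : Type := malg Γ C.

Section GroupAlgebra.
Variables (C : numClosedFieldType) (Γ : zmodType).
Notation galg := (galg C Γ).

HB.instance Definition _ := GRing.Lmodule.on galg.

Definition gdelta (a : Γ) : galg := mkmalgU a 1.

Definition gcoeff (a : Γ) (g : galg) : C := mcoeff a g.

Definition glift (W : lmodType C) (f : Γ -> W) (g : galg) : W :=
  \sum_(a <- msupp g) gcoeff a g *: f a.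

Lemma gcoeff_linear a : linear (gcoeff a : galg -> C^o).
Proof. by move=> c g h; rewrite /gcoeff mcoeffD mcoeffZ. Qed.

Lemma gcoeff_delta a b : gcoeff a (gdelta b) = (b == a)%:R.
Proof. by rewrite /gcoeff mcoeffU. Qed.

Lemma galg_eqP (g h : galg) : (forall a, gcoeff a g = gcoeff a h) -> g = h.
Proof. by move=> gh; apply/malgP => a; exact: gh. Qed.

Lemma gliftEw (W : lmodType C) (f : Γ -> W) (g : galg) (r : seq Γ) :
  uniq r -> {subset msupp g <= r} ->
  glift f g = \sum_(a <- r) gcoeff a g *: f a.
Proof.
move=> ur gr; rewrite /glift [RHS](bigID (mem (msupp g))) /=.
rewrite [X in _ + X]big1 ?addr0; last first.
  by move=> a /mcoeff_outdom ag; rewrite /gcoeff ag scale0r.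
rewrite -[RHS]big_filter; apply: perm_big; apply: uniq_perm.
- exact: fset_uniq.
- exact: filter_uniq.
- move=> a; rewrite mem_filter andb_idr //; exact: gr.
Qed.

Lemma glift_linear (W : lmodType C) (f : Γ -> W) : linear (glift f).
Proof.
move=> c g h.
pose r := undup (msupp g ++ msupp h ++ msupp (c *: g + h)).
have ur : uniq r by exact: undup_uniq.
have sg : {subset msupp g <= r}.
  by move=> a ag; rewrite mem_undup !mem_cat ag.
have sh : {subset msupp h <= r}.
  by move=> a ag; rewrite mem_undup !mem_cat ag orbT.
have sgh : {subset msupp (c *: g + h) <= r}.
  by move=> a ag; rewrite mem_undup !mem_cat ag !orbT.
rewrite (gliftEw f ur sg) (gliftEw f ur sh) (gliftEw f ur sgh).
rewrite scaler_sumr -big_split /=; apply: eq_bigr => a _.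
by rewrite scalerA -scalerDl (gcoeff_linear a c g h).
Qed.

Lemma glift_delta (W : lmodType C) (f : Γ -> W) a : glift f (gdelta a) = f a.
Proof.
rewrite (@gliftEw _ _ _ [:: a]) //; last first.
  by rewrite /gdelta msuppU oner_eq0 => b; rewrite in_fset1 mem_seq1.
by rewrite big_seq1 gcoeff_delta eqxx scale1r.
Qed.

Lemma galg_sum (g : galg) : g = glift gdelta g.
Proof.
apply: galg_eqP => a.
rewrite {1}/glift (lin_sum (gcoeff_linear a)) /gcoeff.
rewrite {1}[g]monalgE raddf_sum /=; apply: eq_bigr => b _.
by rewrite mcoeffZ !mcoeffU mulrnAr mulr1.
Qed.

Lemma galg_ext (W : lmodType C) (f h : galg -> W) : linear f -> linear h ->
  (forall a, f (gdelta a) = h (gdelta a)) -> f =1 h.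
Proof.
move=> lf lh fh g; rewrite [g]galg_sum /glift !lin_sum //.
by apply: eq_bigr => a _; rewrite !linZ // fh.
Qed.

Lemma eq_glift (W : lmodType C) (f h : Γ -> W) : f =1 h -> glift f =1 glift h.
Proof. by move=> fh g; apply: eq_bigr => a _; rewrite fh. Qed.

Lemma glift_lincomb (W : lmodType C) (f h : Γ -> W) c g :
  glift (fun a => c *: f a + h a) g = c *: glift f g + glift h g.
Proof.
rewrite /glift scaler_sumr -big_split; apply: eq_bigr => a _ /=.
by rewrite scalerDr !scalerA mulrC.
Qed.

Definition gmul (g h : galg) : galg :=
  glift (fun a => glift (fun b => gdelta (a + b)) h) g.
Definition gone : galg := gdelta 0.

Lemma gmul_bilin : bilin gmul.
Proof.
split=> [h|g c h h'] /=; first exact: glift_linear.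
rewrite /gmul -glift_lincomb; apply: eq_glift => a; exact: glift_linear.
Qed.

Lemma gmull h : linear (gmul^~ h). Proof. exact: gmul_bilin.1. Qed.
Lemma gmulr g : linear (gmul g). Proof. exact: gmul_bilin.2. Qed.

Lemma gmul_delta a b : gmul (gdelta a) (gdelta b) = gdelta (a + b).
Proof. by rewrite /gmul !glift_delta. Qed.

Lemma gmulA : associative gmul.
Proof.
move=> f g h.
apply: (@galg_ext galg (fun f => gmul f (gmul g h))
  (fun f => gmul (gmul f g) h) _ _ _ f) => [||a {f}].
- exact: gmull.
- by apply: lin_comp; exact: gmull.
apply: (@galg_ext galg (fun g => gmul (gdelta a) (gmul g h))
  (fun g => gmul (gmul (gdelta a) g) h) _ _ _ g) => [||b {g}].
- by apply: lin_comp; [exact: gmulr|exact: gmull].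
- by apply: (lin_comp (gmull h)); exact: gmulr.
apply: (@galg_ext galg (fun h => gmul (gdelta a) (gmul (gdelta b) h))
  (fun h => gmul (gmul (gdelta a) (gdelta b)) h) _ _ _ h) => [||c {h}].
- by apply: lin_comp; exact: gmulr.
- exact: gmulr.
by rewrite !gmul_delta addrA.
Qed.

Lemma gmul1g : left_id gone gmul.
Proof.
move=> g; apply: (galg_ext (@gmulr gone) (h := id)) => // a.
by rewrite gmul_delta add0r.
Qed.

Lemma gmulg1 : right_id gone gmul.
Proof.
move=> g; apply: (galg_ext (@gmull gone) (h := id)) => // a.
by rewrite gmul_delta addr0.
Qed.

Lemma gmulDl : left_distributive gmul +%R.
Proof. by move=> f g h; exact: (linD (@gmull h)). Qed.

Lemma gmulDr : right_distributive gmul +%R.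
Proof. by move=> f g h; exact: (linD (@gmulr f)). Qed.

Lemma gone_neq0 : gone != 0.
Proof. by rewrite /gone /gdelta monalgU_eq0 oner_eq0. Qed.

HB.instance Definition _ := GRing.Zmodule_isNzRing.Build galg
  gmulA gmul1g gmulg1 gmulDl gmulDr gone_neq0.

Lemma gscalerAl (c : C) (g h : galg) : c *: (g * h) = (c *: g) * h.
Proof. by rewrite -[LHS](linZ (@gmull h)). Qed.

HB.instance Definition _ := GRing.Lmodule_isLalgebra.Build C galg gscalerAl.

Lemma gscalerAr (c : C) (g h : galg) : c *: (g * h) = g * (c *: h).
Proof. by rewrite -[LHS](linZ (@gmulr g)). Qed.

HB.instance Definition _ := GRing.Lalgebra_isAlgebra.Build C galg gscalerAr.

Definition gcomul : galg -> galg ⊗ galg := glift (fun a => gdelta a ⊗ gdelta a).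
Definition gcounit : galg -> C := glift (fun=> 1 : C^o).
Definition gantip : galg -> galg := glift (fun a => gdelta (- a)).
Definition gstar (g : galg) : galg :=
  \sum_(a <- msupp g) (gcoeff a g)^* *: gdelta (- a).

End GroupAlgebra.

Section GroupHopf.
Variables (C : numClosedFieldType) (Γ : zmodType).
Notation galg := (galg C Γ).
Notation gdelta := (@gdelta C Γ).

Lemma gmulE (g h : galg) : g * h = gmul g h. Proof. by []. Qed.

Lemma gcoeff_gstar a (g : galg) : gcoeff a (gstar g) = (gcoeff (- a) g)^*.
Proof.
rewrite /gstar (lin_sum (gcoeff_linear a)).
rewrite [in RHS](galg_sum g) /glift (lin_sum (gcoeff_linear (- a))) rmorph_sum.
apply: eq_bigr => b _; rewrite !(linZ (gcoeff_linear _)) !gcoeff_delta.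
have -> : (- b == a) = (b == - a) by rewrite eqr_oppLR.
by case: (b == - a); rewrite /GRing.scale /= ?mulr1 ?mulr0 ?conjC0.
Qed.

Lemma gstar_antilinear : antilinear (@gstar C Γ).
Proof.
move=> c g h; apply: galg_eqP => a.
have /= -> := gcoeff_linear a (c^*) (gstar g) (gstar h).
rewrite !gcoeff_gstar.
have /= -> := gcoeff_linear (- a) c g h.
by rewrite rmorphD rmorphM.
Qed.

Lemma gstar_linear : linear (@gstar C Γ : galg -> cmod galg).
Proof. exact: gstar_antilinear. Qed.

Lemma gstar_delta a : gstar (gdelta a) = gdelta (- a).
Proof.
apply: galg_eqP => b; rewrite gcoeff_gstar !gcoeff_delta conjC_nat.
by rewrite eqr_oppLR.
Qed.

Lemma gstarK : involutive (@gstar C Γ).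
Proof.
by move=> g; apply: galg_eqP => a; rewrite !gcoeff_gstar opprK conjCK.
Qed.

Lemma gstarM (g h : galg) : gstar (g * h) = gstar h * gstar g.
Proof.
apply: (@galg_ext _ _ (cmod galg) (fun g => gstar (gmul g h))
  (fun g => gmul (gstar h) (gstar g)) _ _ _ g) => [||a {g}].
- move=> c u v; rewrite (gmull h); exact: gstar_linear.
- by move=> c u v; rewrite (gstar_linear c u v) /= cmodE; exact: (gmulr (gstar h)).
apply: (@galg_ext _ _ (cmod galg) (fun h => gstar (gmul (gdelta a) h))
  (fun h => gmul (gstar h) (gstar (gdelta a))) _ _ _ h) => [||b {h}].
- move=> c u v; rewrite (gmulr _); exact: gstar_linear.
- by move=> c u v; rewrite (gstar_linear c u v) /= cmodE; exact: (gmull (gstar (gdelta a))).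
by rewrite !(gmul_delta, gstar_delta) opprD addrC.
Qed.

Lemma gcomul_linear : linear (@gcomul C Γ). Proof. exact: glift_linear. Qed.
Lemma gcounit_linear : linear (@gcounit C Γ : galg -> C^o).
Proof. exact: glift_linear. Qed.
Lemma gantip_linear : linear (@gantip C Γ). Proof. exact: glift_linear. Qed.

Lemma gcomul_delta a : gcomul (gdelta a) = gdelta a ⊗ gdelta a.
Proof. exact: glift_delta. Qed.
Lemma gcounit_delta a : gcounit (gdelta a) = 1.
Proof. exact: (@glift_delta _ _ C^o). Qed.
Lemma gantip_delta a : gantip (gdelta a) = gdelta (- a).
Proof. exact: glift_delta. Qed.

Lemma id_linear (U : lmodType C) : linear (@id U). Proof. by []. Qed.

Lemma ginvolution : is_involution *%R (@gstar C Γ).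
Proof. by split; [exact: gstar_antilinear|exact: gstarK|exact: gstarM]. Qed.

Lemma bilin_scalel (V W : lmodType C) (f : V -> C) :
  linear (f : V -> C^o) -> bilin (fun (y : V) (z : W) => f y *: z).
Proof.
move=> lf; split=> [z c y y'|y c z z'] /=.
  by rewrite (lf c y y') scalerDl -scalerA.
by rewrite scalerDr !scalerA mulrC.
Qed.

Lemma bilin_scaler (V W : lmodType C) (f : V -> C) :
  linear (f : V -> C^o) -> bilin (fun (z : W) (y : V) => f y *: z).
Proof. by move=> /(@bilin_scalel V W)[b1 b2]; split. Qed.

Lemma gcoalgebra : is_coalgebra (@gcomul C Γ) (@gcounit C Γ).
Proof.
have li := @id_linear galg; have ld := gcomul_linear.
split=> [||g|g|g].
- exact: gcomul_linear.
- exact: gcounit_linear.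
- apply: (@galg_ext _ _ _ (fun g => tassoc (tmap (@gcomul C Γ) id (gcomul g)))
   (fun g => tmap id (@gcomul C Γ) (gcomul g)) _ _ _ g) => [||a {g}].
  + by do 2?apply: lin_comp => //; [exact: tassoc_linear|exact: tmap_linear].
  + by apply: lin_comp => //; exact: tmap_linear.
  + by rewrite gcomul_delta !tmap_tpure // gcomul_delta tassoc_tpure.
- have b := bilin_scalel galg gcounit_linear.
  apply: (@galg_ext _ _ galg
    (fun g => tlift (fun y z => gcounit y *: z) (gcomul g)) id _ _ _ g) => [||a] //.
    by apply: (lin_comp (tlift_linear b)).
  by rewrite /= gcomul_delta tlift_tpure // gcounit_delta scale1r.
- have b := bilin_scaler galg gcounit_linear.
  apply: (@galg_ext _ _ galg
    (fun g => tlift (fun y z => gcounit z *: y) (gcomul g)) id _ _ _ g) => [||a] //.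
    by apply: (lin_comp (tlift_linear b)).
  by rewrite /= gcomul_delta tlift_tpure // gcounit_delta scale1r.
Qed.

Lemma gcomulM (g h : galg) :
  gcomul (g * h) = tmul *%R *%R (gcomul g) (gcomul h).
Proof.
have bg := @gmul_bilin C Γ; have bt := tmul_bilin bg bg; have ld := gcomul_linear.
apply: (@galg_ext _ _ _ (fun g => gcomul (gmul g h))
  (fun g => tmul (@gmul C Γ) (@gmul C Γ) (gcomul g) (gcomul h)) _ _ _ g)
  => [||a {g}].
- by apply: lin_comp => //; exact: gmull.
- by apply: (lin_comp (bt.1 (gcomul h))).
apply: (@galg_ext _ _ _ (fun h => gcomul (gmul (gdelta a) h))
  (fun h => tmul (@gmul C Γ) (@gmul C Γ) (gcomul (gdelta a)) (gcomul h)) _ _ _ h)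
  => [||b {h}].
- by apply: lin_comp => //; exact: gmulr.
- by apply: (lin_comp (bt.2 (gcomul (gdelta a)))).
by rewrite gmul_delta !gcomul_delta tmul_tpure // gmul_delta.
Qed.

Lemma gcomul_star (g : galg) :
  gcomul (gstar g) = tstar (@gstar C Γ) (@gstar C Γ) (gcomul g).
Proof.
have as_ := gstar_antilinear; have ld := gcomul_linear.
apply: (@galg_ext _ _ (cmod (galg ⊗ galg)%type) (fun g => gcomul (gstar g))
  (fun g => tstar (@gstar C Γ) (@gstar C Γ) (gcomul g)) _ _ _ g) => [||a {g}].
- by move=> c u v; rewrite (as_ c u v); exact: ld.
- by move=> c u v; rewrite ld; exact: tstar_antilinear.
by rewrite gstar_delta !gcomul_delta tstar_tpure // gstar_delta.
Qed.

Lemma gcounitM (g h : galg) : gcounit (g * h) = gcounit g * gcounit h.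
Proof.
have lc := gcounit_linear.
apply: (@galg_ext _ _ C^o (fun g => gcounit (gmul g h))
  (fun g => gcounit g * gcounit h) _ _ _ g) => [||a {g}].
- by move=> c u v; rewrite (gmull h); exact: lc.
- by move=> c u v; rewrite (lc c u v) /GRing.scale /= mulrDl mulrA.
apply: (@galg_ext _ _ C^o (fun h => gcounit (gmul (gdelta a) h))
  (fun h => gcounit (gdelta a) * gcounit h) _ _ _ h) => [||b {h}].
- by move=> c u v; rewrite gmulr; exact: lc.
- by move=> c u v; rewrite (lc c u v) /GRing.scale /= mulrDr !mulrA [_ * c]mulrC.
by rewrite gmul_delta !gcounit_delta mulr1.
Qed.

Lemma gcounit_star (g : galg) : gcounit (gstar g) = (gcounit g)^*.
Proof.
have lc := gcounit_linear.
apply: (@galg_ext _ _ (cmod C^o) (fun g => gcounit (gstar g))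
  (fun g => (gcounit g)^*) _ _ _ g) => [||a {g}].
- by move=> c u v; rewrite (gstar_antilinear c u v); exact: lc.
- by move=> c u v; rewrite (lc c u v) rmorphD rmorphM.
by rewrite gstar_delta !gcounit_delta conjC1.
Qed.

Lemma gantipode :
  is_antipode 1 *%R (@gcomul C Γ) (@gcounit C Γ) (@gantip C Γ).
Proof.
have ls := gantip_linear; have ld := gcomul_linear; have lc := gcounit_linear.
split=> [|g|g]; first exact: gantip_linear.
- have b : bilin (fun y z : galg => gmul (gantip y) z).
    split=> [z|y]; last exact: gmulr.
    by apply: (lin_comp (@gmull _ _ z)).
  apply: (@galg_ext _ _ galg (fun g => tlift (fun y z => gmul (gantip y) z) (gcomul g))
    (fun g => gcounit g *: 1) _ _ _ g) => [||a {g}].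
  + by apply: (lin_comp (tlift_linear b)).
  + by move=> c u v; rewrite (lc c u v) scalerDl -scalerA.
  by rewrite gcomul_delta tlift_tpure // gantip_delta gmul_delta addNr
             gcounit_delta scale1r.
- have b : bilin (fun y z : galg => gmul y (gantip z)).
    split=> [z|y]; first exact: gmull.
    by apply: (lin_comp (@gmulr _ _ y)).
  apply: (@galg_ext _ _ galg (fun g => tlift (fun y z => gmul y (gantip z)) (gcomul g))
    (fun g => gcounit g *: 1) _ _ _ g) => [||a {g}].
  + by apply: (lin_comp (tlift_linear b)).
  + by move=> c u v; rewrite (lc c u v) scalerDl -scalerA.
  by rewrite gcomul_delta tlift_tpure // gantip_delta gmul_delta subrr
             gcounit_delta scale1r.
Qed.

Definition group_hopf : hopfStarAlg C := HopfStarAlg ginvolution gcoalgebra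
  (gcomul_delta 0) gcomulM gcomul_star (gcounit_delta 0) gcounitM gcounit_star
  gantipode.

End GroupHopf.

Section GroupHopfMap.
Variables (C : numClosedFieldType) (Γ Γ' : zmodType).

Definition gmap (f : Γ -> Γ') : galg C Γ -> galg C Γ' :=
  glift (fun a => gdelta C (f a)).

Lemma glift_gmap (W : lmodType C) (F : Γ' -> W) (f : Γ -> Γ') (p : galg C Γ) :
  glift F (gmap f p) = glift (fun a => F (f a)) p.
Proof.
apply: (@galg_ext _ _ _ (fun p => glift F (gmap f p)) (glift (fun a => F (f a))))
  => [||a]; [|exact: glift_linear|by rewrite /gmap !glift_delta].
by apply: lin_comp; exact: glift_linear.
Qed.

End GroupHopfMap.

(** * Bicharacters *)

Record bicharacter (C : numClosedFieldType) (Γ : zmodType) := Bicharacter {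
  bichar :> Γ -> Γ -> C;
  bicharDl : forall a b c, bichar (a + b) c = bichar a c * bichar b c;
  bicharDr : forall a b c, bichar a (b + c) = bichar a b * bichar a c;
  bichar_norm : forall a b, `|bichar a b| = 1 }.

Section Bicharacters.
Variable C : numClosedFieldType.

Definition bext (Γ : zmodType) (β : bicharacter C Γ) (p q : galg C Γ) : C :=
  glift (fun a => glift (fun b => β a b : C^o) q) p.

Variables (Γ Γ' : zmodType) (i : {additive Γ' -> Γ}) (β : bicharacter C Γ).

Lemma bich_pullDl a b c :
  β (i (a + b)) (i c) = β (i a) (i c) * β (i b) (i c).
Proof. by rewrite raddfD bicharDl. Qed.
Lemma bich_pullDr a b c :
  β (i a) (i (b + c)) = β (i a) (i b) * β (i a) (i c).
Proof. by rewrite raddfD bicharDr. Qed.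

Definition bich_pull : bicharacter C Γ' :=
  @Bicharacter C Γ' (fun a b => β (i a) (i b)) bich_pullDl bich_pullDr
    (fun a b => bichar_norm β (i a) (i b)).

Lemma bext_pull (p q : galg C Γ') :
  bext bich_pull p q = bext β (gmap i p) (gmap i q).
Proof.
rewrite /bext glift_gmap; apply: eq_glift => a /=.
by rewrite glift_gmap.
Qed.

End Bicharacters.

(** * Braided Hopf ∗-algebras over (C[Γ], β) *)

Section Braided.
Variables (C : numClosedFieldType) (Γ : zmodType).
Notation CΓ := (group_hopf C Γ).

Section Comodules.
Variables U V : lmodType C.

Record is_comodule (δ : U -> U ⊗ CΓ) : Prop := IsComodule {
  coact_linear : linear δ;
  coact_coassoc : forall x,
    tassoc (tmap δ id (δ x)) = tmap id (@hcomul C CΓ) (δ x);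
  coact_counit : forall x,
    tlift (fun y p => @hcounit C CΓ p *: y) (δ x) = x }.

Definition is_comodule_map (δU : U -> U ⊗ CΓ) (δV : V -> V ⊗ CΓ) (f : U -> V) :
    Prop :=
  forall x, δV (f x) = tmap f id (δU x).

Definition trivial_coaction (c : C^o) : C^o ⊗ CΓ := c ⊗ 1.

Definition tensor_coaction (δU : U -> U ⊗ CΓ) (δV : V -> V ⊗ CΓ) (t : U ⊗ V) :
    (U ⊗ V) ⊗ CΓ :=
  tlift (fun x y =>
    tlift (fun x1 p => tlift (fun y1 q => (x1 ⊗ y1) ⊗ (p * q)) (δV y)) (δU x)) t.

End Comodules.

Record is_comodule_star_algebra (A : lmodType C) (one : A) (mul : A -> A -> A)
    (star : A -> A) (δ : A -> A ⊗ CΓ) : Prop := IsComoduleStarAlgebra {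
  csa_algebra : is_algebra one mul;
  csa_involution : is_involution mul star;
  csa_comodule : is_comodule δ;
  coact1 : δ one = one ⊗ 1;
  coactM : forall x y, δ (mul x y) = tmul mul *%R (δ x) (δ y);
  coact_star : forall x, δ (star x) = tstar star (@hstar C CΓ) (δ x) }.

(* Product and involution of A ⊗_β B, with x^{(1)} ⊗ x^{(2)} = δ x. *)
Section BraidedTensorProduct.
Variable β : bicharacter C Γ.
Variables (A B : lmodType C) (mulA : A -> A -> A) (mulB : B -> B -> B).
Variables (starA : A -> A) (starB : B -> B).
Variables (δA : A -> A ⊗ CΓ) (δB : B -> B ⊗ CΓ).

Definition braided_tmul (s t : A ⊗ B) : A ⊗ B :=
  tlift (fun x y => tlift (fun x' y' =>
    tlift (fun y1 q => tlift (fun x'1 p =>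
      bext β q p *: (mulA x x'1 ⊗ mulB y1 y')) (δA x')) (δB y)) t) s.

Definition braided_tstar (t : A ⊗ B) : A ⊗ B :=
  tlift (fun x y =>
    tlift (fun y1 q => tlift (fun x1 p =>
      bext β (@hstar C CΓ q) (@hstar C CΓ p) *: (starA x1 ⊗ starB y1))
      (δA x)) (δB y)) t.

End BraidedTensorProduct.

Record braidedOps (A : lmodType C) := BraidedOps {
  bone : A;
  bmul : A -> A -> A;
  bstar : A -> A;
  bcoact : A -> A ⊗ CΓ;
  bcomul : A -> A ⊗ A;
  bcounit : A -> C;
  bantip : A -> A }.

Record is_braided_hopf_star (β : bicharacter C Γ) (A : lmodType C)
    (X : braidedOps A) : Prop := IsBraidedHopfStar {
  bh_comodule_star_algebra :
    is_comodule_star_algebra (bone X) (bmul X) (bstar X) (bcoact X);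
  bh_coalgebra : is_coalgebra (bcomul X) (bcounit X);
  bh_comul_comodule :
    is_comodule_map (bcoact X) (tensor_coaction (bcoact X) (bcoact X)) (bcomul X);
  bh_comul1 : bcomul X (bone X) = bone X ⊗ bone X;
  bh_comulM : forall x y, bcomul X (bmul X x y) =
    braided_tmul β (bmul X) (bmul X) (bcoact X) (bcoact X)
      (bcomul X x) (bcomul X y);
  bh_comul_star : forall x, bcomul X (bstar X x) =
    braided_tstar β (bstar X) (bstar X) (bcoact X) (bcoact X) (bcomul X x);
  bh_counit_comodule :
    is_comodule_map (bcoact X) trivial_coaction (bcounit X : A -> C^o);
  bh_counit1 : bcounit X (bone X) = 1;
  bh_counitM : forall x y, bcounit X (bmul X x y) = bcounit X x * bcounit X y;
  bh_counit_star : forall x, bcounit X (bstar X x) = (bcounit X x)^*;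
  bh_antip_comodule : is_comodule_map (bcoact X) (bcoact X) (bantip X);
  bh_antipode :
    is_antipode (bone X) (bmul X) (bcomul X) (bcounit X) (bantip X) }.

End Braided.

Definition with_coaction (C : numClosedFieldType) (Γ Γ' : zmodType)
    (A : lmodType C) (X : braidedOps Γ A) (δ : A -> A ⊗ group_hopf C Γ') :
    braidedOps Γ' A :=
  BraidedOps (bone X) (bmul X) (bstar X) δ (bcomul X) (bcounit X) (bantip X).

(** * Bi-grading and transmutation *)

Section Transmutation.
Variables (C : numClosedFieldType) (Γ : zmodType) (H : hopfStarAlg C).
Variable π : hopfStarMap H (group_hopf C Γ).

Definition bigraded (a b : Γ) (x : H) : Prop :=
  tmap π id (hcomul x) = gdelta C a ⊗ x /\ tmap id π (hcomul x) = x ⊗ gdelta C b.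

Definition ad (x : H) : H ⊗ group_hopf C Γ :=
  tlift (fun x1 y =>
    tlift (fun x2 x3 => x2 ⊗ π (hantip x1 * x3)) (hcomul y)) (hcomul x).

(* The projection of x onto H_{a,b}: see [hproj_bigraded]. *)
Definition hproj (a b : Γ) (x : H) : H :=
  tlift (fun x1 y => gcoeff a (π x1) *:
    tlift (fun x2 x3 => gcoeff b (π x3) *: x2) (hcomul y)) (hcomul x).

Variable β : bicharacter C Γ.

(* The structure maps of H_β are prescribed on bihomogeneous elements; they are
   extended by summing over the finitely many nonzero components ([hproj_finite]).
   See [transm_mul_bigraded], [transm_star_bigraded], [transm_antip_bigraded]. *)
Definition transm_mul (x y : H) : H :=
  \sum_(p \in [set: Γ * Γ]) \sum_(q \in [set: Γ * Γ])
    β (p.2 - p.1) (- q.1) *: (hproj p.1 p.2 x * hproj q.1 q.2 y).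

Definition transm_star (x : H) : H :=
  \sum_(p \in [set: Γ * Γ]) β (p.2 - p.1) (- p.1) *: hstar (hproj p.1 p.2 x).

Definition transm_antip (x : H) : H :=
  \sum_(p \in [set: Γ * Γ]) β (p.2 - p.1) p.2 *: hantip (hproj p.1 p.2 x).

Definition transmutation : braidedOps Γ H :=
  BraidedOps 1 transm_mul transm_star ad (@hcomul C H) (@hcounit C H)
    transm_antip.

End Transmutation.

Section TransmutationTheory.
Variables (C : numClosedFieldType) (Γ : zmodType) (H : hopfStarAlg C).
Variable π : hopfStarMap H (group_hopf C Γ).

Let π_linear : linear π.
Proof. by move=> c x y; rewrite linearP. Qed.

Lemma tlift_tmap (U V U' V' W : lmodType C) (f : U' -> V' -> W)
    (g : U -> U') (h : V -> V') t : bilin f -> linear g -> linear h ->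
  tlift f (tmap g h t) = tlift (fun u v => f (g u) (h v)) t.
Proof.
move=> bf lg lh.
rewrite {1}/tmap {2}/tlift /tsum (lin_sum (tlift_linear bf)).
by apply: eq_bigr => p _; rewrite tlift_tpure.
Qed.

Lemma hprojr_bilin b :
  bilin (fun (z : H) (g : group_hopf C Γ) => gcoeff b g *: z).
Proof. exact: (bilin_scaler H (gcoeff_linear b)). Qed.

Lemma hprojl_bilin a (R : H -> H) : linear R ->
  bilin (fun (g : group_hopf C Γ) y => gcoeff a g *: R y).
Proof.
have [b1 b2] := bilin_scalel H (gcoeff_linear (C := C) (Γ := Γ) a).
by move=> lR; split=> [y|g] /=; [exact: b1|exact: (lin_comp (b2 g))].
Qed.

Lemma hproj_bigraded a b a' b' x : bigraded π a b x ->
  hproj π a' b' x = if (a', b') == (a, b) then x else 0.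
Proof.
move=> [xa xb].
have hE y : tlift (fun x2 x3 => gcoeff b' (π x3) *: x2) (hcomul y) =
    tlift (fun (z : H) (g : group_hopf C Γ) => gcoeff b' g *: z)
      (tmap id π (hcomul y)).
  by rewrite tlift_tmap //; exact: hprojr_bilin.
pose R (y : H) := tlift (fun (z : H) (g : group_hopf C Γ) => gcoeff b' g *: z)
      (tmap id π (hcomul y)).
have lR : linear R.
  apply: (lin_comp (tlift_linear (hprojr_bilin b'))).
  apply: (lin_comp (tmap_linear (@id_linear _ H) π_linear)).
  exact: comul_linear (hopf_coalg H).
rewrite /hproj.
rewrite (@eq_tlift _ _ _ _ _ (fun x1 y => gcoeff a' (π x1) *: R y)); last first.
  by move=> x1 y; rewrite hE.
rewrite -(@tlift_tmap _ _ _ _ _ (fun (g : group_hopf C Γ) y => gcoeff a' g *: R y)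
   π id) //; last exact: hprojl_bilin.
rewrite xa tlift_tpure; last exact: hprojl_bilin.
rewrite /R xb tlift_tpure; last exact: hprojr_bilin.
rewrite !gcoeff_delta xpair_eqE eq_sym [b == b']eq_sym.
by case: eqP => _; case: eqP => _; rewrite ?scale1r ?scale0r.
Qed.

Lemma hproj_finite x : finite_set [set p | hproj π p.1 p.2 x != 0].
Proof.
pose rA := flatten [seq enum_fset (msupp (π p.1)) | p <- repr (hcomul x)].
pose rB := flatten [seq flatten [seq enum_fset (msupp (π q.2)) |
  q <- repr (hcomul p.2)] | p <- repr (hcomul x)].
apply: (@sub_finite_set _ _ [set` allpairs pair rA rB]); last exact: finite_seq.
move=> [a b] /= h0; apply/allpairsP; exists (a, b); split=> //=.
- apply: contraNT h0 => aA; rewrite /hproj /tlift /tsum big_seq big1 // => p pr.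
  rewrite /gcoeff mcoeff_outdom ?scale0r //; apply: contra aA => ap.
  by apply/flatten_mapP; exists p.
- apply: contraNT h0 => bB; rewrite /hproj /tlift /tsum big_seq big1 // => p pr.
  rewrite [X in _ *: X]big_seq [X in _ *: X]big1 ?scaler0 // => q qr.
  rewrite /gcoeff mcoeff_outdom ?scale0r //; apply: contra bB => bq.
  by apply/flatten_mapP; exists p => //; apply/flatten_mapP; exists q.
Qed.

Lemma fsum_single (I : choiceType) (W : zmodType) (i : I) (F : I -> W) :
  (forall j, j != i -> F j = 0) -> \sum_(j \in [set: I]) F j = F i.
Proof.
move=> F0; rewrite -(@fsbig_widen _ _ _ _ [set i]) ?fsbig_set1 //.
by move=> j [_ /eqP ji]; exact: F0.
Qed.

Variable β : bicharacter C Γ.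

Lemma transm_mul_bigraded a b c d x y :
  bigraded π a b x -> bigraded π c d y ->
  transm_mul π β x y = β (b - a) (- c) *: (x * y).
Proof.
move=> xab ycd; rewrite /transm_mul (@fsum_single _ _ (a, b)) /=; last first.
  move=> [a' b'] /negPf ab'; rewrite (@fsum_single _ _ (0, 0)) /= => [|q _];
    by rewrite (hproj_bigraded _ _ xab) ab' mul0r scaler0.
rewrite (@fsum_single _ _ (c, d)) /=; last first.
  by move=> [c' d'] /negPf cd'; rewrite (hproj_bigraded _ _ ycd) cd' mulr0 scaler0.
by rewrite (hproj_bigraded _ _ xab) (hproj_bigraded _ _ ycd) !eqxx.
Qed.

Lemma transm_star_bigraded a b x : bigraded π a b x ->
  transm_star π β x = β (b - a) (- a) *: hstar x.
Proof.
move=> xab; have star0 : hstar (0 : H) = 0.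
  exact: (@lin0 _ _ (cmod H) _ (star_antilinear (hopf_star H))).
rewrite /transm_star (@fsum_single _ _ (a, b)) /=.
  by rewrite (hproj_bigraded _ _ xab) eqxx.
by move=> [a' b'] /negPf ab'; rewrite (hproj_bigraded _ _ xab) ab' star0 scaler0.
Qed.

Lemma transm_antip_bigraded a b x : bigraded π a b x ->
  transm_antip π β x = β (b - a) b *: hantip x.
Proof.
move=> xab; have antip0 : hantip (0 : H) = 0.
  exact: (lin0 (antip_linear (hopf_antip H))).
rewrite /transm_antip (@fsum_single _ _ (a, b)) /=.
  by rewrite (hproj_bigraded _ _ xab) eqxx.
by move=> [a' b'] /negPf ab'; rewrite (hproj_bigraded _ _ xab) ab' antip0 scaler0.
Qed.

End TransmutationTheory.

(** * Duals of topological abelian groups *)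

Record dual (C : numClosedFieldType) (T : topologicalZmodType) := Character {
  char_fun :> T -> C;
  char_continuous : continuous char_fun;
  charD : forall s t, char_fun (s + t) = char_fun s * char_fun t;
  char_norm : forall t, `|char_fun t| = 1 }.

Section Dual.
Variables (C : numClosedFieldType) (T : topologicalZmodType).
Notation dual := (dual C T).

HB.instance Definition _ := gen_eqMixin dual.
HB.instance Definition _ := gen_choiceMixin dual.

Lemma dualP (χ ψ : dual) : (forall t, χ t = ψ t) -> χ = ψ.
Proof.
case: χ ψ => [f cf fD f1] [g cg gD g1] /= /funext fg; subst g.
by congr Character; exact: Prop_irrelevance.
Qed.

Lemma char0 (χ : dual) : χ 0 = 1.
Proof.
have χ0 : χ 0 != 0 by rewrite -normr_eq0 char_norm oner_eq0.
by apply: (mulfI χ0); rewrite mulr1 -charD addr0.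
Qed.

Lemma dual1_continuous : continuous (fun _ : T => 1 : C).
Proof. exact: cst_continuous. Qed.

Lemma dual1D (s t : T) : 1 = 1 * 1 :> C. Proof. by rewrite mulr1. Qed.

Definition dual_zero : dual :=
  @Character C T (fun=> 1) dual1_continuous dual1D (fun=> normr1 _).

Lemma dual_add_continuous (χ ψ : dual) : continuous (fun t => χ t * ψ t).
Proof.
move=> t; apply: (@continuousM C T); exact: char_continuous.
Qed.

Definition dual_add (χ ψ : dual) : dual.
Proof.
exists (fun t => χ t * ψ t).
- exact: dual_add_continuous.
- by move=> s t; rewrite !charD mulrACA.
- by move=> t; rewrite normrM !char_norm mulr1.
Defined.

Lemma dual_opp_continuous (χ : dual) : continuous (fun t => χ (- t)).
Proof.
move=> t; apply: (@continuous_comp _ _ _ -%R χ); first exact: opp_continuous.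
exact: char_continuous.
Qed.

Definition dual_opp (χ : dual) : dual.
Proof.
exists (fun t => χ (- t)).
- exact: dual_opp_continuous.
- by move=> s t; rewrite opprD charD.
- by move=> t; rewrite char_norm.
Defined.

Lemma dual_addA : associative dual_add.
Proof. by move=> x y z; apply: dualP => t /=; rewrite mulrA. Qed.
Lemma dual_addC : commutative dual_add.
Proof. by move=> x y; apply: dualP => t /=; rewrite mulrC. Qed.
Lemma dual_add0 : left_id dual_zero dual_add.
Proof. by move=> x; apply: dualP => t /=; rewrite mul1r. Qed.
Lemma dual_addN : left_inverse dual_zero dual_opp dual_add.
Proof. by move=> x; apply: dualP => t /=; rewrite -charD addNr char0. Qed.

HB.instance Definition _ :=
  GRing.isZmodule.Build dual dual_addA dual_addC dual_add0 dual_addN.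

Definition closed_subgroup (T0 : set T) : Prop :=
  [/\ closed T0, T0 0, forall s t, T0 s -> T0 t -> T0 (s + t) &
      forall t, T0 t -> T0 (- t)].

(* The characters that are trivial on T0, i.e. the dual of T / T0. *)
Variable T0 : set T.

Definition ann_pred : {pred dual} := fun χ => `[< forall t, T0 t -> χ t = 1 >].

Lemma ann_zmod_closed : zmod_closed ann_pred.
Proof.
split=> [|χ ψ /asboolP hχ /asboolP hψ]; apply/asboolP => t T0t //=.
by have := charD ψ (- t) t; rewrite addNr char0 (hψ t T0t) mulr1 hχ // mul1r => <-.
Qed.

HB.instance Definition _ := GRing.isZmodClosed.Build dual ann_pred ann_zmod_closed.

Record ann := Ann { ann_val :> dual; ann_valP : ann_val \in ann_pred }.

HB.instance Definition _ := [isSub for ann_val].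
HB.instance Definition _ := [Choice of ann by <:].
HB.instance Definition _ := [SubChoice_isSubZmodule of ann by <:].

Definition ann_incl : {additive ann -> dual} := val.

End Dual.

Section Cocentral.
Variables (C : numClosedFieldType) (T : topologicalZmodType).
Variables (H : hopfStarAlg C) (π : hopfStarMap H (group_hopf C (dual C T))).

Definition cocentral (T0 : set T) : Prop :=
  forall a b : dual C T, ~ (forall t, T0 t -> a t = b t) ->
  forall x : H, bigraded π a b x -> x = 0.

End Cocentral.

(* Main.v *)
(* A linear map on H is determined by its values on bihomogeneous elements, and for
   x in H_{a,b} the coproduct of x is a sum of tensors y ⊗ z with y in H_{a,e} and
   z in H_{e,b}; both facts come from slicing the coproduct with the functionals
   "coefficient of a in π". Hence every axiom of a braided Hopf ∗-algebra reduces to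
   the corresponding axiom of H on bihomogeneous elements, together with an identity
   between values of β. Cocentrality says that b - a is trivial on T_0 as soon as
   H_{a,b} is nonzero, so that only degrees in the dual of T / T_0 occur; these are
   the elements of H_{a, a + i(c)} below, i being the inclusion of that dual. *)

Require Import Defs.
From HB Require Import structures.
From mathcomp Require Import all_boot all_order all_algebra.
From mathcomp Require Import all_classical all_reals all_analysis.
From mathcomp Require Import finmap complex ring.
From mathcomp Require Import -(notations) monalg.

Set Implicit Arguments.
Unset Strict Implicit.
Unset Printing Implicit Defensive.

Import Order.TTheory GRing.Theory Num.Theory.

Local Open Scope classical_set_scope.
Local Open Scope ring_scope.

(** The twist in a product depends on two kinds of degree: the coaction degree c = b - a of the left
    factor and the left degree a' of the right factor. Coaction degrees add along Δ, but the left
    degree of the second leg of Δ y is shifted by the coaction degree of the first leg. Comparing Δ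
    of a twisted product with the product of the coproducts therefore leaves a surplus β(c2, -c1'),
    and the braiding of the tensor square supplies exactly its inverse.

    The obstacle on the side of [H] is the antipode: its axioms do not mention Δ of [hantip x], so
    the bidegree of [hantip x] has to be extracted from uniqueness of convolution inverses.

    The group enters abstractly, through an injective additive map [i] whose image contains every
    difference b - a that occurs. The coaction of the smaller group algebra is [ad] followed by a
    linear retraction of the inclusion, so its axioms can be tested on bihomogeneous elements like
    all the others. *)

Section Linearity.

(** * Linear and bilinear maps on tensor products *)

Variable K : fieldType.
Implicit Types U V W X : lmodType K.

Lemma bilinP U V W (f : U -> V -> W) :
  (forall v, linear (fun u => f u v)) -> (forall u, linear (f u)) -> bilin f.
Proof. by move=> fl fr; split=> [v|u]; [exact: fl|exact: fr]. Qed.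

Lemma linear_id U : linear (fun u : U => u). Proof. by []. Qed.

Lemma linearZf U W (f : U -> W) c : linear f -> linear (fun u => c *: f u).
Proof. by move=> lf d u v; rewrite lf scalerDr !scalerA mulrC. Qed.

Lemma linear_scale U W (f : U -> K) (w : W) :
  linear (f : U -> K^o) -> linear (fun u => f u *: w).
Proof. by move=> lf c u v; rewrite (lf c u v) scalerDl -scalerA. Qed.

Lemma linear_tpurel U V X (f : X -> U) (v : V) :
  linear f -> linear (fun x => f x ⊗ v).
Proof. by move=> lf c x y; rewrite lf tpure_linl. Qed.

Lemma linear_tpurer U V X (u : U) (f : X -> V) :
  linear f -> linear (fun x => u ⊗ f x).
Proof. by move=> lf c x y; rewrite lf tpure_linr. Qed.

Lemma linear_tlift U V W X (f : U -> V -> W) (g : X -> U ⊗ V) :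
  bilin f -> linear g -> linear (fun x => tlift f (g x)).
Proof. by move=> bf lg; apply: (lin_comp (tlift_linear bf)). Qed.

Lemma linear_tlift_param U V W X (f : X -> U -> V -> W) t :
  (forall u v, linear (fun x => f x u v)) -> linear (fun x => tlift (f x) t).
Proof.
move=> lf c x y; rewrite -tlift_Z -tlift_D; apply: eq_tlift => u v; exact: lf.
Qed.

Lemma linear_tmap U V U' V' X (f : U -> U') (g : V -> V') (h : X -> U ⊗ V) :
  linear f -> linear g -> linear h -> linear (fun x => tmap f g (h x)).
Proof. by move=> lf lg lh; apply: (lin_comp (tmap_linear lf lg)). Qed.

Lemma linear_mulrl (A : algType K) X (f : X -> A) (y : A) :
  linear f -> linear (fun x => f x * y).
Proof. by move=> lf c u v; rewrite lf mulrDl scalerAl. Qed.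

Lemma linear_mulrr (A : algType K) X (f : X -> A) (y : A) :
  linear f -> linear (fun x => y * f x).
Proof. by move=> lf c u v; rewrite lf mulrDr scalerAr. Qed.

Lemma mulr_bilin (A : algType K) : bilin ( *%R : A -> A -> A).
Proof. by apply: bilinP => v; [apply: linear_mulrl|apply: linear_mulrr]. Qed.

Lemma lin_tlift U V W X (f : W -> X) (g : U -> V -> W) t :
  linear f -> f (tlift g t) = tlift (fun u v => f (g u v)) t.
Proof. by move=> lf; rewrite /tlift /tsum lin_sum. Qed.

Lemma tlift_pure U V (t : U ⊗ V) : tlift (@tpure K U V) t = t.
Proof. by rewrite [RHS]tens_sum. Qed.

Lemma tlift_tpurel U V W X (g : U -> V -> W) (x : X) t :
  tlift (fun u v => g u v ⊗ x) t = tlift g t ⊗ x.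
Proof. exact/esym/(lin_tlift g t (linear_tpurel x (@linear_id _))). Qed.

Lemma tlift_tpurer U V W X (g : U -> V -> W) (x : X) t :
  tlift (fun u v => x ⊗ g u v) t = x ⊗ tlift g t.
Proof. exact/esym/(lin_tlift g t (linear_tpurer x (@linear_id _))). Qed.

Lemma tens_ind U V (P : U ⊗ V -> Prop) :
  P 0 -> (forall s t, P s -> P t -> P (s + t)) -> (forall u v, P (u ⊗ v)) ->
  forall t, P t.
Proof. by move=> P0 PD Pp t; rewrite [t]tens_sum; elim/big_ind: _. Qed.

Lemma tmap_comp U V U' V' U'' V'' (f : U' -> U'') (g : V' -> V'')
    (f' : U -> U') (g' : V -> V') t :
  linear f -> linear g -> linear f' -> linear g' ->
  tmap f g (tmap f' g' t) = tmap (fun u => f (f' u)) (fun v => g (g' v)) t.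
Proof.
move=> lf lg lf' lg'; rewrite {2}/tmap (lin_tlift _ _ (tmap_linear lf lg)).
by apply: eq_tlift => u v; rewrite tmap_tpure.
Qed.

Lemma eq_tmap U V U' V' (f f' : U -> U') (g g' : V -> V') :
  f =1 f' -> g =1 g' -> tmap f g =1 tmap f' g'.
Proof. by move=> ff gg t; apply: eq_tlift => u v; rewrite ff gg. Qed.

End Linearity.

(** * Tensor products of algebras *)

Section TensorAlgebra.
Variables (K : fieldType) (A B : algType K).

Let mulA_bilin := mulr_bilin A.
Let mulB_bilin := mulr_bilin B.
Notation tm := (tmul ( *%R : A -> A -> A) ( *%R : B -> B -> B)).

Lemma tmulr_bilin : bilin tm. Proof. exact: tmul_bilin. Qed.

Lemma tmulrA : associative tm.
Proof.
have [bl br] := tmulr_bilin.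
move=> x y z; elim/tens_ind: x => [|s t Ps Pt|u v].
- by rewrite !(lin0 (bl _)).
- by rewrite !(linD (bl _)) Ps Pt.
elim/tens_ind: y => [|s t Ps Pt|u' v'].
- by rewrite (lin0 (bl _)) (lin0 (br _)) (lin0 (bl _)).
- by rewrite (linD (bl _)) !(linD (br _)) (linD (bl _)) Ps Pt.
elim/tens_ind: z => [|s t Ps Pt|u'' v''].
- by rewrite !(lin0 (br _)).
- by rewrite !(linD (br _)) Ps Pt.
by rewrite !tmul_tpure // !mulrA.
Qed.

Lemma tmulr1 t : tm t (1 ⊗ 1) = t.
Proof.
have [bl br] := tmulr_bilin.
elim/tens_ind: t => [|s t Ps Pt|u v]; first by rewrite (lin0 (bl _)).
- by rewrite (linD (bl _)) Ps Pt.
- by rewrite tmul_tpure // !mulr1.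
Qed.

Lemma tmul1r t : tm (1 ⊗ 1) t = t.
Proof.
have [bl br] := tmulr_bilin.
elim/tens_ind: t => [|s t Ps Pt|u v]; first by rewrite (lin0 (br _)).
- by rewrite (linD (br _)) Ps Pt.
- by rewrite tmul_tpure // !mul1r.
Qed.

End TensorAlgebra.

Lemma tmap_tmul (K : fieldType) (A B A' B' : algType K)
    (f : A -> A') (g : B -> B') s t : linear f -> linear g ->
  {morph f : x y / x * y} -> {morph g : x y / x * y} ->
  tmap f g (tmul *%R *%R s t) = tmul *%R *%R (tmap f g s) (tmap f g t).
Proof.
move=> lf lg fM gM.
have [bl br] := tmulr_bilin A B; have [bl' br'] := tmulr_bilin A' B'.
have lt := tmap_linear lf lg.
elim/tens_ind: s => [|s s' Ps Ps'|u v].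
- by rewrite (lin0 (bl _)) !(lin0 lt) (lin0 (bl' _)).
- by rewrite (linD (bl _)) !(linD lt) (linD (bl' _)) Ps Ps'.
elim/tens_ind: t => [|t t' Pt Pt'|u' v'].
- by rewrite (lin0 (br _)) !(lin0 lt) (lin0 (br' _)).
- by rewrite (linD (br _)) !(linD lt) (linD (br' _)) Pt Pt'.
by rewrite !(tmul_tpure, tmap_tpure) ?fM ?gM //; exact: mulr_bilin.
Qed.

Lemma tmulr_algebra (C : numClosedFieldType) (A B : algType C) :
  @is_algebra C (A ⊗ B)%type (1 ⊗ 1) (tmul *%R *%R).
Proof.
split; [exact: tmulr_bilin|exact: tmulrA|exact: tmul1r|exact: tmulr1].
Qed.

(** * Antilinear maps, treated as linear maps into the conjugate module *)

Section Antilinearity.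
Variable C : numClosedFieldType.
Implicit Types U V W X : lmodType C.

Lemma antilinD U W (f : U -> W) : antilinear f -> {morph f : u v / u + v}.
Proof. by move=> af; exact: (@linD _ _ (cmod W) f). Qed.

Lemma antilinZ U W (f : U -> W) : antilinear f ->
  forall a u, f (a *: u) = a^* *: f u.
Proof. by move=> af; exact: (@linZ _ _ (cmod W) f). Qed.

Lemma antilin_tlift U V W X (f : W -> X) (g : U -> V -> W) t :
  antilinear f -> f (tlift g t) = tlift (fun u v => f (g u v)) t.
Proof. by move=> af; exact: (@lin_tlift _ _ _ _ (cmod X) f). Qed.

Lemma tmap_tstar U V U' V' (f : U -> U') (g : V -> V') sU sV sU' sV' t :
  linear f -> linear g -> antilinear sU' -> antilinear sV' ->
  (forall u, f (sU u) = sU' (f u)) -> (forall v, g (sV v) = sV' (g v)) ->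
  tmap f g (tstar sU sV t) = tstar sU' sV' (tmap f g t).
Proof.
move=> lf lg aU aV fs gs.
rewrite {1}/tstar (lin_tlift _ _ (tmap_linear lf lg)).
rewrite [in RHS]/tmap (antilin_tlift _ _ (tstar_antilinear aU aV)).
apply: eq_tlift => u v; rewrite tmap_tpure // tstar_tpure //.
by rewrite fs gs.
Qed.

End Antilinearity.

(** * Sweedler calculus and convolution *)

Section Coalgebra.
Variables (C : numClosedFieldType) (A : lmodType C).
Variables (comul : A -> A ⊗ A) (counit : A -> C).
Hypothesis coA : is_coalgebra comul counit.

(** A trilinear [f] factors through [A ⊗ (A ⊗ A)], where coassociativity is an equality of tensors.
    This form replaces Sweedler notation for threefold coproducts. *)
Lemma coassocE (W : lmodType C) (f : A -> A -> A -> W) x :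
  (forall y z, linear (fun x => f x y z)) ->
  (forall x z, linear (fun y => f x y z)) ->
  (forall x y, linear (f x y)) ->
  tlift (fun y z => tlift (f y) (comul z)) (comul x) =
  tlift (fun y z => tlift (fun y1 y2 => f y1 y2 z) (comul y)) (comul x).
Proof.
move=> l1 l2 l3; have lD := comul_linear coA.
have b12 z : bilin (fun x y => f x y z) by apply: bilinP.
have b23 y : bilin (f y) by apply: bilinP.
pose F := tlift (fun y (t : A ⊗ A) => tlift (f y) t).
have bF : bilin (fun y (t : A ⊗ A) => tlift (f y) t).
  apply: bilinP => [t|y]; first exact: linear_tlift_param.
  exact: tlift_linear.
have lF : linear F by exact: tlift_linear.
have Fassoc t z : F (tassoc (t ⊗ z)) = tlift (fun y1 y2 => f y1 y2 z) t.
  rewrite /tassoc tlift_tpure; last exact: bilin_tassoc.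
  by rewrite (lin_tlift _ _ lF); apply: eq_tlift => u v; rewrite /F !tlift_tpure.
transitivity (F (tmap id comul (comul x))).
  by rewrite /F tlift_tmap.
rewrite -(coassoc coA) /tmap (lin_tlift _ _ (@tassoc_linear _ _ _ _)) (lin_tlift _ _ lF).
by apply: eq_tlift => y z; exact: Fassoc.
Qed.

(** With · for convolution, f = f·(g·h) = (f·g)·h = h. It serves to identify maps built from the
    antipode without assuming that the antipode reverses products or coproducts. *)
Lemma convolution_inverse_unique (W : lmodType C) (one : W) (mul : W -> W -> W)
    (f g h : A -> W) : is_algebra one mul ->
  linear f -> linear g -> linear h ->
  (forall x, tlift (fun y z => mul (f y) (g z)) (comul x) = counit x *: one) ->
  (forall x, tlift (fun y z => mul (g y) (h z)) (comul x) = counit x *: one) ->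
  f =1 h.
Proof.
move=> [[bl br] mA m1l m1r] lf lg lh fg gh x.
rewrite -{1}[x](counitr coA) (lin_tlift _ _ lf) -{2}[x](counitl coA) (lin_tlift _ _ lh).
transitivity (tlift (fun y z => tlift (fun z1 z2 => mul (f y) (mul (g z1) (h z2)))
    (comul z)) (comul x)).
  apply: eq_tlift => y z; rewrite -(lin_tlift _ _ (br (f y))) gh.
  by rewrite (linZ lf) (linZ (br _)) m1r.
rewrite coassocE => [|y z|y z|y z].
- apply: eq_tlift => y z.
  under eq_tlift do rewrite mA.
  by rewrite -(lin_tlift _ _ (bl (h z))) fg (linZ lh) (linZ (bl _)) m1l.
- exact: (lin_comp (bl _)).
- by apply: (lin_comp (br _)); exact: (lin_comp (bl _)).
- by do 2!apply: (lin_comp (br _)).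
Qed.

End Coalgebra.

(** * Bihomogeneous components *)

Section Projections.
Variables (C : numClosedFieldType) (Γ : zmodType) (H : hopfStarAlg C).
Variable π : hopfStarMap H (group_hopf C Γ).
Notation CΓ := (group_hopf C Γ).
Notation gdelta := (gdelta C).

Let coH := hopf_coalg H.

Lemma hmap_linear : linear π.
Proof. by move=> c x y; rewrite linearP. Qed.

Let ll := hmap_linear.
Let lD : linear (@hcomul C H) := comul_linear coH.
Let lid := @id_linear C H.

(** Half of [hproj] each: [hproj a b] is [rproj b] after [lproj a]. Separately they are easier to
    handle, because each commutes with Δ on a single leg. *)
Definition lproj (a : Γ) (x : H) : H :=
  tlift (fun y z => gcoeff a (π y) *: z) (hcomul x).
Definition rproj (b : Γ) (x : H) : H :=
  tlift (fun y z => gcoeff b (π z) *: y) (hcomul x).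

Lemma gcoeff_hmap_linear a : linear ((fun x => gcoeff a (π x)) : H -> C^o).
Proof. by move=> c x y; rewrite linearP; exact: gcoeff_linear. Qed.

Let lg := gcoeff_hmap_linear.

Lemma lproj_linear a : linear (lproj a).
Proof. by apply: linear_tlift => //; exact: bilin_scalel. Qed.

Lemma rproj_linear a : linear (rproj a).
Proof. by apply: linear_tlift => //; exact: bilin_scaler. Qed.

Lemma comul_lproj a x : hcomul (lproj a x) = tmap (lproj a) id (hcomul x).
Proof.
rewrite /lproj (lin_tlift _ _ lD).
under eq_tlift do rewrite (linZ lD) -[hcomul _]tlift_pure -tlift_Z.
rewrite (coassocE coH (f := fun u v w => gcoeff a (π u) *: (v ⊗ w))).
- apply: eq_tlift => y z /=; rewrite -tlift_tpurel; apply: eq_tlift => u v.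
  by rewrite (linZ (linear_tpurel z lid)).
- by move=> v w; exact: linear_scale.
- by move=> u w; apply: linearZf; exact: linear_tpurel.
- by move=> u v; apply: linearZf; exact: linear_tpurer.
Qed.

Lemma comul_rproj b x : hcomul (rproj b x) = tmap id (rproj b) (hcomul x).
Proof.
rewrite /rproj (lin_tlift _ _ lD).
under eq_tlift do rewrite (linZ lD) -[hcomul _]tlift_pure -tlift_Z.
rewrite -(coassocE coH (f := fun u v w => gcoeff b (π w) *: (u ⊗ v))).
- apply: eq_tlift => y z /=; rewrite -tlift_tpurer; apply: eq_tlift => u v.
  by rewrite (linZ (linear_tpurer y lid)).
- by move=> v w; apply: linearZf; exact: linear_tpurel.
- by move=> u w; apply: linearZf; exact: linear_tpurer.
- by move=> u v; exact: linear_scale.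
Qed.

(** Both sides apply the coefficient of [e] in [π] to the middle factor of the threefold coproduct.
    This forces the inner degrees of the two legs of Δ x to agree. *)
Lemma comul_rproj_lproj e x :
  tmap (rproj e) id (hcomul x) = tmap id (lproj e) (hcomul x).
Proof.
transitivity (tlift (fun y z =>
    tlift (fun y1 y2 => gcoeff e (π y2) *: (y1 ⊗ z)) (hcomul y)) (hcomul x)).
  apply: eq_tlift => y z /=; rewrite -tlift_tpurel; apply: eq_tlift => u v.
  by rewrite (linZ (linear_tpurel z lid)).
rewrite -(coassocE coH (f := fun u v w => gcoeff e (π v) *: (u ⊗ w))).
- apply: eq_tlift => y z /=; rewrite -tlift_tpurer; apply: eq_tlift => u v.
  by rewrite (linZ (linear_tpurer y lid)).
- by move=> v w; apply: linearZf; exact: linear_tpurel.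
- by move=> u w; exact: linear_scale.
- by move=> u v; apply: linearZf; exact: linear_tpurer.
Qed.

Lemma hmap_lproj a x : π (lproj a x) = gcoeff a (π x) *: gdelta a.
Proof.
transitivity (tlift (fun g h : CΓ => gcoeff a g *: h) (hcomul (π x))).
  rewrite hmap_comul tlift_tmap //; last exact: (bilin_scalel _ (gcoeff_linear a)).
  by rewrite /lproj (lin_tlift _ _ ll); apply: eq_tlift => u v; rewrite (linZ ll).
apply: (@galg_ext _ _ CΓ (fun g => tlift (fun g h : CΓ => gcoeff a g *: h) (gcomul g))
  (fun g => gcoeff a g *: gdelta a)) => [||b].
- apply: linear_tlift; first exact: (bilin_scalel _ (gcoeff_linear a)).
  exact: gcomul_linear.
- exact: (linear_scale _ (gcoeff_linear a)).
rewrite gcomul_delta tlift_tpure; last exact: (bilin_scalel _ (gcoeff_linear a)).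
by rewrite gcoeff_delta; case: eqP => [->|_] //; rewrite !scale0r.
Qed.

Lemma hmap_rproj a x : π (rproj a x) = gcoeff a (π x) *: gdelta a.
Proof.
transitivity (tlift (fun g h : CΓ => gcoeff a h *: g) (hcomul (π x))).
  rewrite hmap_comul tlift_tmap //; last exact: (bilin_scaler _ (gcoeff_linear a)).
  by rewrite /rproj (lin_tlift _ _ ll); apply: eq_tlift => u v; rewrite (linZ ll).
apply: (@galg_ext _ _ CΓ (fun g => tlift (fun g h : CΓ => gcoeff a h *: g) (gcomul g))
  (fun g => gcoeff a g *: gdelta a)) => [||b].
- apply: linear_tlift; first exact: (bilin_scaler _ (gcoeff_linear a)).
  exact: gcomul_linear.
- exact: (linear_scale _ (gcoeff_linear a)).
rewrite gcomul_delta tlift_tpure; last exact: (bilin_scaler _ (gcoeff_linear a)).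
by rewrite gcoeff_delta; case: eqP => [->|_] //; rewrite !scale0r.
Qed.

Lemma comul_hmap_lproj a x :
  tmap π id (hcomul (lproj a x)) = gdelta a ⊗ lproj a x.
Proof.
have la := lproj_linear a.
rewrite comul_lproj tmap_comp // -tlift_tpurer; apply: eq_tlift => y z.
rewrite hmap_lproj (linZ (linear_tpurel z (@id_linear C _))).
by rewrite (linZ (linear_tpurer _ lid)).
Qed.

Lemma comul_hmap_rproj b x :
  tmap id π (hcomul (rproj b x)) = rproj b x ⊗ gdelta b.
Proof.
have lb := rproj_linear b.
rewrite comul_rproj tmap_comp // -tlift_tpurel; apply: eq_tlift => y z.
rewrite hmap_rproj (linZ (linear_tpurer y (@id_linear C _))).
by rewrite (linZ (linear_tpurel _ lid)).
Qed.

(** [lproj a] touches only the first leg of the coproduct while the right degree is read on the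
    second, so the degree fixed by [rproj b] survives. *)
Lemma bigraded_proj a b x : bigraded π a b (lproj a (rproj b x)).
Proof.
have la := lproj_linear a; split; first exact: comul_hmap_lproj.
rewrite comul_lproj tmap_comp //; transitivity (tmap (lproj a) id
    (tmap id π (hcomul (rproj b x)))); first by rewrite tmap_comp.
by rewrite comul_hmap_rproj tmap_tpure.
Qed.

Lemma lproj_bigraded a b x : bigraded π a b x -> lproj a x = x.
Proof.
move=> [xa _]; have bc := bilin_scalel H (@gcoeff_linear C Γ a).
transitivity (tlift (fun (g : CΓ) z => gcoeff a g *: z) (tmap π id (hcomul x))).
  by rewrite tlift_tmap.
by rewrite xa tlift_tpure // gcoeff_delta eqxx scale1r.
Qed.

Lemma rproj_bigraded a b x : bigraded π a b x -> rproj b x = x.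
Proof.
move=> [_ xb]; have bc := bilin_scaler H (@gcoeff_linear C Γ b).
transitivity (tlift (fun z (g : CΓ) => gcoeff b g *: z) (tmap id π (hcomul x))).
  by rewrite tlift_tmap.
by rewrite xb tlift_tpure // gcoeff_delta eqxx scale1r.
Qed.

Lemma lproj_idem a x : lproj a (lproj a x) = lproj a x.
Proof.
have bc := bilin_scalel H (@gcoeff_linear C Γ a).
transitivity (tlift (fun (g : CΓ) z => gcoeff a g *: z)
    (tmap π id (hcomul (lproj a x)))); first by rewrite tlift_tmap.
by rewrite comul_hmap_lproj tlift_tpure // gcoeff_delta eqxx scale1r.
Qed.

(** Since [π] preserves the counit, this turns the counit axiom of [H] into the statement that the
    slices by degree add up to the identity. *)
Lemma gcounit_sum (g : CΓ) (r : seq Γ) : uniq r -> {subset msupp g <= r} ->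
  \sum_(a <- r) gcoeff a g = hcounit g.
Proof.
move=> ur gr; rewrite /hcounit /= /gcounit (gliftEw _ ur gr).
by apply: eq_bigr => a _; rewrite /GRing.scale /= mulr1.
Qed.

(* Stated for all large enough index sequences, so that finitely many elements
   can share one. *)
Lemma lproj_sum x : exists r : seq Γ, forall r', uniq r' -> {subset r <= r'} ->
  \sum_(a <- r') lproj a x = x.
Proof.
exists (flatten [seq (msupp (π p.1) : seq Γ) | p <- repr (hcomul x)]) => r' ur' rr'.
rewrite -[RHS](counitl coH) /lproj /tlift /tsum exchange_big /=.
rewrite big_seq [RHS]big_seq; apply: eq_bigr => p pr.
rewrite -scaler_suml gcounit_sum ?hmap_counit // => a ap.
by apply: rr'; apply/flatten_mapP; exists p.
Qed.

Lemma rproj_sum x : exists r : seq Γ, \sum_(a <- r) rproj a x = x.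
Proof.
pose r := undup (flatten [seq (msupp (π p.2) : seq Γ) | p <- repr (hcomul x)]).
exists r; rewrite -[RHS](counitr coH) /rproj /tlift /tsum exchange_big /=.
rewrite big_seq [RHS]big_seq; apply: eq_bigr => p pr.
rewrite -scaler_suml gcounit_sum ?hmap_counit // ?undup_uniq // => a ap.
by rewrite mem_undup; apply/flatten_mapP; exists p.
Qed.

Lemma bigraded_ind (P : H -> Prop) :
  P 0 -> (forall x y, P x -> P y -> P (x + y)) ->
  (forall a b x, bigraded π a b x -> P x) -> forall x, P x.
Proof.
move=> P0 PD Pb x; have [r <-] := rproj_sum x.
elim/big_ind: _ => // b _; have [r' rE] := lproj_sum (rproj b x).
rewrite -(rE (undup r')) ?undup_uniq // => [|a]; last by rewrite mem_undup.
by elim/big_ind: _ => // a _; exact/Pb/bigraded_proj.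
Qed.

Lemma tens_lproj_sum (t : H ⊗ H) : exists r : seq Γ, forall r', uniq r' ->
  {subset r <= r'} -> \sum_(a <- r') tmap id (lproj a) t = t.
Proof.
have lt a := tmap_linear lid (lproj_linear a).
elim/tens_ind: t => [|s t [rs sE] [rt tE]|u v].
- by exists [::] => r' _ _; rewrite big1 // => a _; rewrite (lin0 (lt a)).
- exists (rs ++ rt) => r' ur' rr'; under eq_bigr do rewrite (linD (lt _)).
  by rewrite big_split /= sE ?tE // => a ar; apply: rr'; rewrite mem_cat ar ?orbT.
- have [r rE] := lproj_sum v; exists r => r' ur' rr'.
  rewrite -[in RHS](rE r') // (lin_sum (linear_tpurer u lid)).
  by apply: eq_bigr => a _; rewrite tmap_tpure //; exact: lproj_linear.
Qed.

Lemma comul_bigraded_ind a b (P : H ⊗ H -> Prop) :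
  P 0 -> (forall s t, P s -> P t -> P (s + t)) ->
  (forall e y z, bigraded π a e y -> bigraded π e b z -> P (y ⊗ z)) ->
  forall x, bigraded π a b x -> P (hcomul x).
Proof.
move=> P0 PD Pb x xab; have [r rE] := tens_lproj_sum (hcomul x).
rewrite -(rE (undup r)) ?undup_uniq // => [|e]; last by rewrite mem_undup.
elim/big_ind: _ => // e _.
have la := @lproj_linear; have lr := @rproj_linear.
have lrr c d : linear (fun x => lproj c (rproj d x)) by apply: (lin_comp (la c)).
(* The outer projections come for free because x is bihomogeneous; the inner one on the first leg is
   a second copy of [lproj e], inserted by idempotence and moved across as [rproj e]. *)
suff -> : tmap id (lproj e) (hcomul x) =
    tmap (fun y => lproj a (rproj e y)) (fun z => lproj e (rproj b z)) (hcomul x).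
  by rewrite /tmap /tlift /tsum; elim/big_ind: _ => // p _;
    apply: Pb; exact: bigraded_proj.
rewrite -{1}(lproj_bigraded xab) comul_lproj tmap_comp //.
transitivity (tmap (lproj a) (lproj e) (tmap id (lproj e) (hcomul x))).
  by rewrite tmap_comp //; apply: eq_tmap => y //; rewrite lproj_idem.
rewrite -comul_rproj_lproj -{1}(rproj_bigraded xab) comul_rproj.
by rewrite !tmap_comp //; apply: (lin_comp (g := rproj b)).
Qed.

End Projections.

(** * Bidegrees of the structure maps of [H], and the adjoint coaction *)

Section Bigraded.
Variables (C : numClosedFieldType) (Γ : zmodType) (H : hopfStarAlg C).
Variable π : hopfStarMap H (group_hopf C Γ).
Notation CΓ := (group_hopf C Γ).
Notation gdelta := (gdelta C).
Notation bigraded := (bigraded π).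

Let coH := hopf_coalg H.
Let ll := hmap_linear π.
Let lD : linear (@hcomul C H) := comul_linear coH.
Let lS : linear (@hantip C H) := antip_linear (hopf_antip H).
Let lSΓ : linear (@hantip C CΓ) := antip_linear (hopf_antip CΓ).
Let lid := @linear_id C H.

Lemma morph0 (U W : zmodType) (f : U -> W) : {morph f : x y / x + y} -> f 0 = 0.
Proof. by move=> fD; apply: (@addrI _ (f 0)); rewrite -fD !addr0. Qed.

(** Only additivity is asked, so that the principle covers linear and antilinear maps alike. *)
Lemma bigraded_ext (W : zmodType) (f g : H -> W) :
  {morph f : x y / x + y} -> {morph g : x y / x + y} ->
  (forall a b x, bigraded a b x -> f x = g x) -> f =1 g.
Proof.
move=> fD gD; apply: bigraded_ind => [|x y fx fy]; first by rewrite !morph0.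
by rewrite fD gD fx fy.
Qed.

Lemma comul_bigraded_ext (W : zmodType) (f g : H ⊗ H -> W) a b x :
  {morph f : s t / s + t} -> {morph g : s t / s + t} ->
  (forall e y z, bigraded a e y -> bigraded e b z -> f (y ⊗ z) = g (y ⊗ z)) ->
  bigraded a b x -> f (hcomul x) = g (hcomul x).
Proof.
move=> fD gD fg; apply: (comul_bigraded_ind (P := fun t => f t = g t)) => //.
  by rewrite !morph0.
by move=> s t fs ft; rewrite fD gD fs ft.
Qed.

Lemma bigraded1 : bigraded 0 0 1.
Proof. by rewrite /bigraded hcomul1 !tmap_tpure // rmorph1. Qed.

Lemma bigradedM a b c d x y : bigraded a b x -> bigraded c d y ->
  bigraded (a + c) (b + d) (x * y).
Proof.
move=> [xa xb] [yc yd]; have bm := @mulr_bilin _ H; have bg := @mulr_bilin _ CΓ.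
split; rewrite hcomulM tmap_tmul // ?(xa, yc) ?(xb, yd) ?tmul_tpure //;
  by [rewrite gmulE gmul_delta|exact: rmorphM].
Qed.

Lemma bigraded_star a b x : bigraded a b x -> bigraded (- a) (- b) (hstar x).
Proof.
move=> [xa xb]; have aH := star_antilinear (hopf_star H).
have aG := star_antilinear (hopf_star CΓ).
by split; rewrite hcomul_star (tmap_tstar _ (sU' := @hstar C _) (sV' := @hstar C _)) //;
  rewrite ?xa ?xb ?tstar_tpure // -?gstar_delta //; exact: hmap_star.
Qed.

(** The two counit axioms give π x = ε(x) a and π x = ε(x) b, and distinct group elements are
    linearly independent in C[Γ]. *)
Lemma counit_bigraded a b x : bigraded a b x -> a != b -> hcounit x = 0.
Proof.
move=> [xa xb] ab; have lc : linear (@hcounit C H : H -> C^o) := counit_linear coH.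
have πa : π x = hcounit x *: gdelta a.
  have bc := bilin_scaler CΓ lc.
  rewrite -{1}[x](counitr coH) (lin_tlift _ _ ll).
  transitivity (tlift (fun (g : CΓ) y => hcounit y *: g) (tmap π id (hcomul x))).
    by rewrite tlift_tmap //; apply: eq_tlift => y z; rewrite (linZ ll).
  by rewrite xa tlift_tpure.
have πb : π x = hcounit x *: gdelta b.
  have bc := bilin_scalel CΓ lc.
  rewrite -{1}[x](counitl coH) (lin_tlift _ _ ll).
  transitivity (tlift (fun y (g : CΓ) => hcounit y *: g) (tmap id π (hcomul x))).
    by rewrite tlift_tmap //; apply: eq_tlift => y z; rewrite (linZ ll).
  by rewrite xb tlift_tpure.
have /(congr1 (gcoeff a)) : hcounit x *: gdelta a = hcounit x *: gdelta b.
  by rewrite -πa.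
rewrite !(linZ (gcoeff_linear a)) !gcoeff_delta eqxx eq_sym (negPf ab).
by rewrite /GRing.scale /= mulr1 mulr0.
Qed.

(* Both sides are convolution inverses of (π ⊗ id)Δ, the right one extended
   linearly by h. *)
Lemma antip_comul_left a b x : bigraded a b x ->
  tmap π id (hcomul (hantip x)) = gdelta (- b) ⊗ hantip x.
Proof.
pose lam (x : H) := tmap π id (hcomul x).
pose h (x : H) := tlift (fun z (g : CΓ) => hantip g ⊗ hantip z) (tmap id π (hcomul x)).
have bSS : bilin (fun (z : H) (g : CΓ) => hantip g ⊗ hantip z).
  by apply: bilinP => v; [exact: linear_tpurer|exact: linear_tpurel].
have llam : linear lam by apply: linear_tmap.
have lh : linear h by apply: linear_tlift => //; exact: linear_tmap.
have hE c d y : bigraded c d y -> h y = gdelta (- d) ⊗ hantip y.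
  by move=> [_ yd]; rewrite /h yd tlift_tpure // -gantip_delta.
have algW := tmulr_algebra CΓ H; have [bl br] := alg_bilin algW.
move=> xab; rewrite -(hE _ _ _ xab).
apply: (convolution_inverse_unique coH algW (f := fun x => lam (hantip x))
  (g := lam)) => // [|y|y].
- exact: (lin_comp llam).
- transitivity (lam (tlift (fun y z => hantip y * z) (hcomul y))).
    rewrite (lin_tlift _ _ llam); apply: eq_tlift => u v.
    by rewrite /lam hcomulM tmap_tmul //; exact: rmorphM.
  rewrite (antipl (hopf_antip H)) (linZ llam) /lam hcomul1 tmap_tpure //.
  by rewrite rmorph1.
- have lc : linear (@hcounit C H : H -> C^o) := counit_linear coH.
  have bc : bilin (fun y z => tmul *%R *%R (lam y) (h z)).
    by apply: bilinP => u; [exact: (lin_comp (bl _))|exact: (lin_comp (br _))].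
  have bm : bilin (fun y z : H => y * hantip z).
    by apply: bilinP => u; [exact: linear_mulrl|exact: linear_mulrr].
  move: y; apply: bigraded_ext => [||c d y ycd].
  + by apply: linD; exact: linear_tlift.
  + by apply: linD; exact: linear_scale.
  (* The first leg contributes [gdelta c] and the second [gdelta (- d)], whatever the middle degree
     is. The antipode axiom then leaves ε(y), which vanishes unless c = d. *)
  transitivity (gdelta (c - d) ⊗ tlift (fun y z => y * hantip z) (hcomul y)).
    apply: (comul_bigraded_ext (f := fun t => tlift _ t)
      (g := fun t => _ ⊗ tlift _ t) _ _ _ ycd) => [||e u v uce ved].
    * by apply: linD; exact: tlift_linear.
    * by apply: linD; apply: linear_tpurer; exact: tlift_linear.
    rewrite !tlift_tpure // (hE _ _ _ ved) /lam (proj1 uce) tmul_tpure.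
    - by rewrite gmulE gmul_delta.
    - exact: mulr_bilin.
    - exact: mulr_bilin.
  rewrite (antipr (hopf_antip H)) (linZ (linear_tpurer _ lid)).
  have [<-|cd] := eqVneq c d; first by rewrite subrr.
  by rewrite (counit_bigraded ycd cd) !scale0r.
Qed.

(* As above, with (id ⊗ π)Δ. *)
Lemma antip_comul_right a b x : bigraded a b x ->
  tmap id π (hcomul (hantip x)) = hantip x ⊗ gdelta (- a).
Proof.
pose lam (x : H) := tmap id π (hcomul x).
pose h (x : H) := tlift (fun (g : CΓ) z => hantip z ⊗ hantip g) (tmap π id (hcomul x)).
have bSS : bilin (fun (g : CΓ) (z : H) => hantip z ⊗ hantip g).
  by apply: bilinP => v; [exact: linear_tpurer|exact: linear_tpurel].
have llam : linear lam by apply: linear_tmap.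
have lh : linear h by apply: linear_tlift => //; exact: linear_tmap.
have hE c d y : bigraded c d y -> h y = hantip y ⊗ gdelta (- c).
  by move=> [yc _]; rewrite /h yc tlift_tpure // -gantip_delta.
have algW := tmulr_algebra H CΓ; have [bl br] := alg_bilin algW.
move=> xab; rewrite -(hE _ _ _ xab).
apply: (convolution_inverse_unique coH algW (f := fun x => lam (hantip x))
  (g := lam)) => // [|y|y].
- exact: (lin_comp llam).
- transitivity (lam (tlift (fun y z => hantip y * z) (hcomul y))).
    rewrite (lin_tlift _ _ llam); apply: eq_tlift => u v.
    by rewrite /lam hcomulM tmap_tmul //; exact: rmorphM.
  rewrite (antipl (hopf_antip H)) (linZ llam) /lam hcomul1 tmap_tpure //.
  by rewrite rmorph1.
- have lc : linear (@hcounit C H : H -> C^o) := counit_linear coH.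
  have bc : bilin (fun y z => tmul *%R *%R (lam y) (h z)).
    by apply: bilinP => u; [exact: (lin_comp (bl _))|exact: (lin_comp (br _))].
  have bm : bilin (fun y z : H => y * hantip z).
    by apply: bilinP => u; [exact: linear_mulrl|exact: linear_mulrr].
  move: y; apply: bigraded_ext => [||c d y ycd].
  + by apply: linD; exact: linear_tlift.
  + by apply: linD; exact: linear_scale.
  (* On this side both group-like factors carry the middle degree e, with opposite signs, and cancel
     term by term. *)
  transitivity (tlift (fun y z => y * hantip z) (hcomul y) ⊗ (1 : CΓ)).
    apply: (comul_bigraded_ext (f := fun t => tlift _ t)
      (g := fun t => tlift _ t ⊗ _) _ _ _ ycd) => [||e u v uce ved].
    * by apply: linD; exact: tlift_linear.
    * by apply: linD; apply: linear_tpurel; exact: tlift_linear.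
    rewrite !tlift_tpure // (hE _ _ _ ved) /lam (proj2 uce) tmul_tpure.
    - by rewrite gmulE gmul_delta subrr.
    - exact: mulr_bilin.
    - exact: mulr_bilin.
  by rewrite (antipr (hopf_antip H)) (linZ (linear_tpurel _ lid)).
Qed.

Lemma bigraded_antip a b x : bigraded a b x -> bigraded (- b) (- a) (hantip x).
Proof.
by move=> xab; split; [apply: antip_comul_left xab|apply: antip_comul_right xab].
Qed.

Lemma ad_linear : linear (ad π).
Proof.
apply: linear_tlift => //; apply: bilinP => [y|x].
  apply: linear_tlift_param => u v; apply: linear_tpurer.
  by apply: (lin_comp ll); exact: linear_mulrl.
apply: linear_tlift => //; apply: bilinP => u; first exact: linear_tpurel.
by apply: linear_tpurer; apply: (lin_comp ll); exact: linear_mulrr.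
Qed.

Lemma ad_bigraded a b x : bigraded a b x -> ad π x = x ⊗ gdelta (b - a).
Proof.
move=> xab; have bS : bilin (fun (g : CΓ) (y : H) => y ⊗ (hantip g * gdelta b)).
  apply: bilinP => u; last exact: linear_tpurel.
  by apply: linear_tpurer; exact: linear_mulrl.
(* The second leg of Δ x has right degree b, which makes the third Sweedler factor the constant
   [gdelta b]; the left degree of x then settles the first factor. *)
transitivity (tlift (fun (g : CΓ) y => y ⊗ (hantip g * gdelta b))
    (tmap π id (hcomul x))); last first.
  by rewrite (proj1 xab) tlift_tpure // gmulE [hantip _]gantip_delta gmul_delta addrC.
rewrite tlift_tmap //.
have bu (u : H) : bilin (fun (y : H) (g : CΓ) => y ⊗ (hantip (π u) * g)).
  by apply: bilinP => v; [exact: linear_tpurel|apply: linear_tpurer; exact: linear_mulrr].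
have E u v : tlift (fun x2 x3 => x2 ⊗ π (hantip u * x3)) (hcomul v) =
    tlift (fun (y : H) (g : CΓ) => y ⊗ (hantip (π u) * g)) (tmap id π (hcomul v)).
  by rewrite tlift_tmap //; apply: eq_tlift => y z;
  rewrite -hmap_antip; congr (_ ⊗ _); exact: rmorphM.
have bL : bilin (fun u v : H => tlift (fun (y : H) (g : CΓ) => y ⊗ (hantip (π u) * g))
    (tmap id π (hcomul v))).
  apply: bilinP => [v|u].
    apply: linear_tlift_param => y g; apply: linear_tpurer.
    by apply: linear_mulrl; apply: (lin_comp lSΓ).
  by apply: linear_tlift => //; exact: linear_tmap.
have bR : bilin (fun u v : H => v ⊗ (hantip (π u) * gdelta b)).
  apply: bilinP => u; last exact: linear_tpurel.
  by apply: linear_tpurer; apply: linear_mulrl; exact: (lin_comp lSΓ).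
rewrite /ad; under eq_tlift do rewrite E.
apply: (comul_bigraded_ext (f := fun t => tlift _ t) (g := fun t => tlift _ t)
  _ _ _ xab) => [||e u v _ veb].
- by apply: linD; exact: tlift_linear.
- by apply: linD; exact: tlift_linear.
by rewrite [LHS]tlift_tpure // [RHS]tlift_tpure // (proj2 veb) tlift_tpure.
Qed.

End Bigraded.

(** * Finitely supported sums *)

Section FiniteSums.
Variable C : numClosedFieldType.

Lemma fsum_seq (I : choiceType) (W : zmodType) (F : I -> W) (r : seq I) :
  uniq r -> (forall j, j \notin r -> F j = 0) ->
  \sum_(j \in [set: I]) F j = \sum_(j <- r) F j.
Proof.
move=> ur F0; rewrite (fsbig_seq _ _ ur); apply/esym/fsbig_widen => // j [_ jr].
by apply: F0; apply/negP.
Qed.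

(** Such a sum defaults to 0 on infinite support, so linearity is proved on a finite index set that
    carries the supports of both u and v. *)
Lemma fsum_linear (I : choiceType) (U W : lmodType C) (F : I -> U -> W) :
  (forall j, linear (F j)) ->
  (forall u, finite_set [set j | F j u != 0]) ->
  linear (fun u => \sum_(j \in [set: I]) F j u).
Proof.
move=> lF finF c u v.
have /finite_fsetP[A AE] : finite_set ([set j | F j u != 0] `|` [set j | F j v != 0]).
  by rewrite finite_setU; split.
have F0 j : j \notin (A : seq I) -> F j u = 0 /\ F j v = 0.
  move=> jA; split; apply/eqP; apply: contraNT jA => Fj.
    by have : [set` A] j by rewrite -AE; left.
  by have : [set` A] j by rewrite -AE; right.
rewrite !(fsum_seq (r := A)) ?fset_uniq //= => [|j /F0[] //|j /F0[] //|j /F0[u0 v0]].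
  rewrite scaler_sumr -big_split; apply: eq_bigr => j _; exact: lF.
by rewrite lF u0 v0 scaler0 addr0.
Qed.

End FiniteSums.

(** * Linearity of the twisted structure maps *)

Section TransmutationLinearity.
Variables (C : numClosedFieldType) (Γ : zmodType) (H : hopfStarAlg C).
Variables (π : hopfStarMap H (group_hopf C Γ)) (β : bicharacter C Γ).

Lemma hprojE a b x : hproj π a b x = rproj π b (lproj π a x).
Proof.
rewrite /lproj (lin_tlift _ _ (rproj_linear π b)); apply: eq_tlift => u v.
by rewrite (linZ (rproj_linear π b)).
Qed.

Lemma hproj_linear a b : linear (hproj π a b).
Proof.
move=> c x y; rewrite !hprojE lproj_linear; exact: rproj_linear.
Qed.

Lemma fsum_hproj_linear (W : lmodType C) (F : Γ * Γ -> H -> W) :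
  (forall p, linear (F p)) ->
  linear (fun x => \sum_(p \in [set: Γ * Γ]) F p (hproj π p.1 p.2 x)).
Proof.
move=> lF; apply: fsum_linear => [p|x].
  by apply: (lin_comp (lF p)); exact: hproj_linear.
apply: sub_finite_set (hproj_finite π x) => p /=.
by apply: contra_neq => ->; rewrite (lin0 (lF p)).
Qed.

Lemma transm_mul_bilin : bilin (transm_mul π β).
Proof.
have lm (p q : Γ * Γ) (z : H) : linear (fun x : H => β (p.2 - p.1) (- q.1) *: (x * z)).
  by apply: linearZf; exact: linear_mulrl.
apply: bilinP => [y|x].
  pose F (p : Γ * Γ) x := \sum_(q \in [set: Γ * Γ])
    β (p.2 - p.1) (- q.1) *: (x * hproj π q.1 q.2 y).
  apply: (fsum_hproj_linear (F := F)) => p; apply: fsum_linear => // x.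
  apply: sub_finite_set (hproj_finite π y) => q /=.
  by apply: contra_neq => ->; rewrite mulr0 scaler0.
pose F (p q : Γ * Γ) y := β (p.2 - p.1) (- q.1) *: (hproj π p.1 p.2 x * y).
have lF p : linear (fun y => \sum_(q \in [set: Γ * Γ]) F p q (hproj π q.1 q.2 y)).
  apply: (fsum_hproj_linear (F := F p)) => q; apply: linearZf.
  exact: linear_mulrr.
apply: fsum_linear => // y; apply: sub_finite_set (hproj_finite π x) => p /=.
apply: contra_neq => p0; rewrite (fsum_seq (r := [::])) ?big_nil // => q _.
by rewrite /F p0 mul0r scaler0.
Qed.

Lemma transm_star_antilinear : antilinear (transm_star π β).
Proof.
pose F (p : Γ * Γ) x : cmod H := β (p.2 - p.1) (- p.1) *: (hstar x : H).
apply: (@fsum_hproj_linear (cmod H) F) => p c x y.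
rewrite /F (star_antilinear (hopf_star H)) scalerDr !scalerA mulrC.
by rewrite -scalerA.
Qed.

Lemma transm_antip_linear : linear (transm_antip π β).
Proof.
pose F (p : Γ * Γ) (x : H) := β (p.2 - p.1) p.2 *: hantip x.
apply: (fsum_hproj_linear (F := F)) => p; apply: linearZf.
exact: antip_linear (hopf_antip H).
Qed.

End TransmutationLinearity.

(** * Values of a bicharacter *)

Section BraidedTensorLinearity.
Variables (C : numClosedFieldType) (Γ : zmodType) (β : bicharacter C Γ).
Notation CΓ := (group_hopf C Γ).

Lemma bext_bilin : bilin (bext β : CΓ -> CΓ -> C^o).
Proof.
apply: bilinP => [q|p]; first exact: glift_linear.
move=> c q q'; rewrite /bext -[RHS]glift_lincomb; apply: eq_glift => a.
exact: glift_linear.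
Qed.

Lemma bext_delta a b : bext β (gdelta C a) (gdelta C b) = β a b.
Proof. by rewrite /bext !(@glift_delta _ _ C^o). Qed.

Lemma bichar_neq0 a b : β a b != 0.
Proof. by rewrite -normr_eq0 bichar_norm oner_eq0. Qed.

Lemma bichar0l b : β 0 b = 1.
Proof. by apply: (mulfI (bichar_neq0 0 b)); rewrite -bicharDl addr0 mulr1. Qed.

Lemma bichar0r a : β a 0 = 1.
Proof. by apply: (mulfI (bichar_neq0 a 0)); rewrite -bicharDr addr0 mulr1. Qed.

Lemma bicharNl a b : β (- a) b = (β a b)^-1.
Proof.
apply: (mulfI (bichar_neq0 a b)).
by rewrite -bicharDl subrr bichar0l divff ?bichar_neq0.
Qed.

Lemma bicharNr a b : β a (- b) = (β a b)^-1.
Proof.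
apply: (mulfI (bichar_neq0 a b)).
by rewrite -bicharDr subrr bichar0r divff ?bichar_neq0.
Qed.

Lemma conj_bichar a b : (β a b)^* = (β a b)^-1.
Proof. by rewrite invC_norm bichar_norm expr1n invr1 mul1r. Qed.

End BraidedTensorLinearity.

(** * The transmutation over a smaller group *)

Section CocentralTransmutation.
Variables (C : numClosedFieldType) (Γ Γ' : zmodType) (i : {additive Γ' -> Γ}).
Variables (H : hopfStarAlg C) (π : hopfStarMap H (group_hopf C Γ)).
Variable β : bicharacter C Γ.
Hypothesis i_inj : injective i.
(** The algebraic form of cocentrality. Only the difference of the two degrees lifts to Γ'; the left
    degree stays in Γ, whence the mixed indexing of [hom]. *)
Hypothesis deg_i : forall a b (x : H), bigraded π a b x -> x != 0 ->
  exists c, i c = b - a.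

Notation CΓ := (group_hopf C Γ).
Notation CΓ' := (group_hopf C Γ').
Notation gdelta := (gdelta C).
Notation m := (transm_mul π β).
Notation s := (transm_star π β).
Notation S := (transm_antip π β).
Notation Δ := (@hcomul C H).
Notation ε := (@hcounit C H).
Notation hom a c := (bigraded π a (a + i c)).

Let coH := hopf_coalg H.
Let lD : linear Δ := comul_linear coH.
Let le : linear (ε : H -> C^o) := counit_linear coH.
Let lid := @linear_id C H.
Let bm : bilin m := transm_mul_bilin π β.
Let bl := bm.1.
Let br := bm.2.
Let sal : antilinear s := transm_star_antilinear π β.
Let lS : linear S := transm_antip_linear π β.
Let bM := @mulr_bilin _ H.
Let bM' := @mulr_bilin _ CΓ'.

Lemma hom_ext (W : zmodType) (f g : H -> W) :
  {morph f : x y / x + y} -> {morph g : x y / x + y} ->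
  (forall a c x, hom a c x -> f x = g x) -> f =1 g.
Proof.
move=> fD gD fg; apply: (@bigraded_ext _ _ _ π) => // a b x xab.
have [->|/(deg_i xab)[c cE]] := eqVneq x 0; first by rewrite !morph0.
by apply: (fg a c); rewrite cE addrC subrK.
Qed.

(** The legs have bidegrees (a, e) and (e, b), so their differences add up to b - a in Γ;
    injectivity of [i] carries this to c = c1 + c2 in Γ'. Tensors with a zero leg, which have no
    degree in Γ', are killed by both maps. *)
Lemma comul_hom_ext (W : zmodType) (f g : H ⊗ H -> W) a c x :
  {morph f : u v / u + v} -> {morph g : u v / u + v} ->
  (forall c1 c2 y z, c = c1 + c2 -> hom a c1 y -> hom (a + i c1) c2 z ->
     f (y ⊗ z) = g (y ⊗ z)) ->
  hom a c x -> f (Δ x) = g (Δ x).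
Proof.
move=> fD gD fg; apply: (comul_bigraded_ext fD gD) => e y z yae zeb.
have [->|/(deg_i yae)[c1 c1E]] := eqVneq y 0.
  by rewrite (lin0 (linear_tpurel z lid)) !morph0.
have [->|/(deg_i zeb)[c2 c2E]] := eqVneq z 0.
  by rewrite (lin0 (linear_tpurer y lid)) !morph0.
have eE : e = a + i c1 by rewrite c1E addrC subrK.
have cE : c = c1 + c2.
  by apply: i_inj; rewrite raddfD /= c1E c2E addrC addrA subrK addrAC subrr add0r.
rewrite eE in yae zeb; apply: (fg c1 c2) => //.
by rewrite -addrA -raddfD -cE.
Qed.

Lemma hom1 : hom 0 0 1.
Proof. by rewrite raddf0 addr0; exact: bigraded1. Qed.

Lemma homM a c x a' c' x' : hom a c x -> hom a' c' x' ->
  hom (a + a') (c + c') (x * x').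
Proof. by move=> xh xh'; rewrite raddfD addrACA; exact: bigradedM. Qed.

Lemma hom_star a c x : hom a c x -> hom (- a) (- c) (hstar x).
Proof. by move=> xh; rewrite raddfN -opprD; exact: bigraded_star. Qed.

Lemma hom_antip a c x : hom a c x -> hom (- (a + i c)) c (hantip x).
Proof. by move=> /bigraded_antip; rewrite opprD subrK. Qed.

(** The counit lives in coaction degree 0, where all the twists are 1. This is why it remains a
    unital ∗-homomorphism for the twisted operations. *)
Lemma counit_hom a c x : hom a c x -> c != 0 -> ε x = 0.
Proof.
move=> /counit_bigraded xh c0; apply: xh.
by rewrite -subr_eq0 opprD addrA subrr add0r oppr_eq0 -(raddf0 i) (inj_eq i_inj).
Qed.

Lemma transm_mul_hom a c x a' c' x' : hom a c x -> hom a' c' x' ->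
  m x x' = β (i c) (- a') *: (x * x').
Proof. by move=> xh xh'; rewrite (transm_mul_bigraded _ xh xh') addrAC subrr add0r. Qed.

Lemma transm_star_hom a c x : hom a c x -> s x = β (i c) (- a) *: hstar x.
Proof. by move=> xh; rewrite (transm_star_bigraded _ xh) addrAC subrr add0r. Qed.

Lemma transm_antip_hom a c x : hom a c x -> S x = β (i c) (a + i c) *: hantip x.
Proof. by move=> xh; rewrite (transm_antip_bigraded _ xh) addrAC subrr add0r. Qed.

(** The conditional expectation onto the group algebra of the subgroup: it retracts [gmap i] and
    kills the group elements outside the image of [i]. It is linear but in general not
    multiplicative. *)
Definition gres : CΓ -> CΓ' := glift (fun g : Γ =>
  if pselect (exists c, i c = g) is left e then gdelta (sval (cid e)) : CΓ' else 0).

Lemma gres_delta c : gres (gdelta (i c)) = gdelta c.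
Proof.
rewrite /gres glift_delta; case: pselect => [e|]; last by case; exists c.
by congr gdelta; apply: i_inj; exact: svalP (cid e).
Qed.

Definition coad (x : H) : H ⊗ CΓ' := tmap id gres (ad π x).
Notation δ := coad.

Let lgres : linear gres. Proof. exact: glift_linear. Qed.

Lemma coad_linear : linear δ.
Proof. by apply: linear_tmap => //; exact: ad_linear. Qed.

Let lδ := coad_linear.

Lemma coad_hom a c x : hom a c x -> δ x = x ⊗ gdelta c.
Proof.
move=> xh; rewrite /coad (ad_bigraded xh) addrAC subrr add0r tmap_tpure //.
by rewrite gres_delta.
Qed.

(** On bihomogeneous elements the group-like factor of [ad] already lies in the image of [i], so the
    retraction loses nothing. *)
Lemma tmap_gmap_coad x : tmap id (gmap i) (δ x) = ad π x.
Proof.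
have lgm : linear (gmap i : CΓ' -> CΓ) by exact: glift_linear.
move: x; apply: hom_ext => [||a c x xh].
- by apply: linD; exact: linear_tmap.
- exact: linD (@ad_linear _ _ _ π).
rewrite (coad_hom xh) tmap_tpure // /gmap glift_delta (ad_bigraded xh).
by rewrite addrAC subrr add0r.
Qed.

(** Bimultiplicativity and unimodularity reduce each scalar identity to one between monomials in
    nonzero values of β and their inverses. *)
Ltac bichar := rewrite ?(raddfD, raddfN, opprD, opprK, bicharDl, bicharDr,
    bicharNl, bicharNr, conj_bichar, rmorphM, fmorphV, invrK) /=;
  field; rewrite ?bichar_neq0.

(** A bicharacter is a 2-cocycle on the group of degrees: with [i] suppressed, both bracketings
    carry β(c, -a') β(c, -a'') β(c', -a''). *)
Lemma transm_mulA : associative m.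
Proof.
move=> x y z; move: x; apply: hom_ext => [||a c x xh].
- exact: linD (bl _).
- by apply: linD; exact: (lin_comp (bl _) (bl _)).
move: y; apply: hom_ext => [||a' c' y yh].
- by apply: linD; exact: (lin_comp (br _) (bl _)).
- by apply: linD; exact: (lin_comp (bl _) (br _)).
move: z; apply: hom_ext => [||a'' c'' z zh].
- by apply: linD; exact: (lin_comp (br _) (br _)).
- exact: linD (br _).
rewrite (transm_mul_hom yh zh) (transm_mul_hom xh yh).
rewrite (linZ (br _)) (linZ (bl _)).
rewrite (transm_mul_hom xh (homM yh zh)) (transm_mul_hom (homM xh yh) zh).
by rewrite mulrA !scalerA; congr (_ *: _); bichar.
Qed.

Lemma transm_algebra : is_algebra 1 m.
Proof.
split=> [//||x|x]; first exact: transm_mulA.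
- move: x; apply: hom_ext => [||a c x xh] //; first exact: linD (br _).
  by rewrite (transm_mul_hom hom1 xh) raddf0 bichar0l scale1r mul1r.
- move: x; apply: hom_ext => [||a c x xh] //; first exact: linD (bl _).
  by rewrite (transm_mul_hom xh hom1) oppr0 bichar0r scale1r mulr1.
Qed.

Lemma transm_involution : is_involution m s.
Proof.
have sD := antilinD sal; have sZ := antilinZ sal.
split=> [//||x y].
- apply: hom_ext => [u v|//|a c x xh]; first by rewrite !sD.
  rewrite (transm_star_hom xh) sZ (transm_star_hom (hom_star xh)).
  rewrite (starK (hopf_star H)) scalerA -[RHS]scale1r; congr (_ *: _).
  by bichar.
move: x; apply: hom_ext => [u v|u v|a c x xh].
- by rewrite (linD (bl _)) sD.
- by rewrite sD (linD (br _)).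
move: y; apply: hom_ext => [u v|u v|a' c' y yh].
- by rewrite (linD (br _)) sD.
- by rewrite sD (linD (bl _)).
rewrite (transm_mul_hom xh yh) sZ (transm_star_hom (homM xh yh)).
rewrite (transm_star_hom xh) (transm_star_hom yh) (linZ (br _)) (linZ (bl _)).
rewrite (transm_mul_hom (hom_star yh) (hom_star xh)) (starM (hopf_star H)).
(* Both sides carry β(c, -a) β(c', -a) β(c', -a'): conjugating the twist of the product inverts it
   and removes the cross term β(c, -a'). *)
by rewrite !scalerA; congr (_ *: _); bichar.
Qed.

Lemma coad_comodule : is_comodule δ.
Proof.
have lDΓ : linear (@hcomul C CΓ') := comul_linear (hopf_coalg CΓ').
have leΓ : linear (@hcounit C CΓ' : _ -> C^o) := counit_linear (hopf_coalg CΓ').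
split=> [//|x|x].
- move: x; apply: hom_ext => [||a c x xh].
  + apply: linD; apply: (lin_comp (@tassoc_linear _ _ _ _)).
    exact: linear_tmap.
  + by apply: linD; exact: linear_tmap.
  by rewrite (coad_hom xh) !tmap_tpure // (coad_hom xh) tassoc_tpure [hcomul _]gcomul_delta.
- have bc := bilin_scaler H leΓ.
  move: x; apply: hom_ext => [||a c x xh] //.
    by apply: linD; exact: linear_tlift.
  by rewrite (coad_hom xh) tlift_tpure // [hcounit _]gcounit_delta scale1r.
Qed.

Lemma coadM x y : δ (m x y) = tmul m *%R (δ x) (δ y).
Proof.
have [tl tr] := tmul_bilin bm bM'.
move: x; apply: hom_ext => [||a c x xh].
- by apply: linD; exact: (lin_comp lδ (bl _)).
- by apply: linD; exact: (lin_comp (tl _) lδ).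
move: y; apply: hom_ext => [||a' c' y yh].
- by apply: linD; exact: (lin_comp lδ (br _)).
- by apply: linD; exact: (lin_comp (tr _) lδ).
rewrite (coad_hom xh) (coad_hom yh) tmul_tpure // (transm_mul_hom xh yh).
rewrite (linZ lδ) (coad_hom (homM xh yh)) gmulE gmul_delta.
by rewrite (linZ (linear_tpurel _ lid)).
Qed.

Lemma coad_star x : δ (s x) = tstar s (@hstar C CΓ') (δ x).
Proof.
have aG := star_antilinear (hopf_star CΓ').
have tD := antilinD (tstar_antilinear sal aG).
move: x; apply: hom_ext => [u v|u v|a c x xh].
- by rewrite (antilinD sal) (linD lδ).
- by rewrite (linD lδ) tD.
rewrite (coad_hom xh) tstar_tpure // [hstar _]gstar_delta (transm_star_hom xh).
by rewrite (linZ lδ) (coad_hom (hom_star xh)) (linZ (linear_tpurel _ lid)).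
Qed.

Lemma transm_comodule_star_algebra : is_comodule_star_algebra 1 m s δ.
Proof.
split; [exact: transm_algebra|exact: transm_involution|exact: coad_comodule| | |].
- exact: coad_hom hom1.
- exact: coadM.
- exact: coad_star.
Qed.

(** * The coaction on [H ⊗ H] and equivariance of the coproduct *)

Section TensorCoaction.

(** The innermost term with all its arguments exposed: a nested lift can be evaluated on pure
    tensors only after each level is shown to be bilinear. *)
Let b1 (u v : H) (p q : CΓ') : H ⊗ H ⊗ CΓ' := (u ⊗ v) ⊗ (p * q).

Let b1l v p q : linear (fun u => b1 u v p q).
Proof. by apply: linear_tpurel; exact: linear_tpurel. Qed.
Let b1p u v q : linear (fun p => b1 u v p q).
Proof. by apply: linear_tpurer; exact: linear_mulrl. Qed.
Let b1r u p : bilin (fun v q => b1 u v p q).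
Proof.
apply: bilinP => w; first by apply: linear_tpurel; exact: linear_tpurer.
by apply: linear_tpurer; exact: linear_mulrr.
Qed.

Let b2 y : bilin (fun u p => tlift (fun v q => b1 u v p q) (δ y)).
Proof. by apply: bilinP => w; apply: linear_tlift_param. Qed.

Let b3 : bilin (fun x y => tlift (fun u p => tlift (fun v q => b1 u v p q) (δ y)) (δ x)).
Proof.
apply: bilinP => w; first exact: linear_tlift.
by apply: linear_tlift_param => u p; exact: linear_tlift.
Qed.

Lemma tensor_coaction_linear : linear (tensor_coaction δ δ).
Proof. exact: tlift_linear b3. Qed.

Lemma tensor_coaction_hom a c x a' c' y : hom a c x -> hom a' c' y ->
  tensor_coaction δ δ (x ⊗ y) = (x ⊗ y) ⊗ gdelta (c + c').
Proof.
move=> xh yh; rewrite /tensor_coaction (tlift_tpure _ _ b3) (coad_hom xh).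
rewrite (tlift_tpure _ _ (b2 y)) (coad_hom yh) (tlift_tpure _ _ (b1r _ _)) /b1.
by rewrite gmulE gmul_delta.
Qed.

End TensorCoaction.

Lemma comul_comodule : is_comodule_map δ (tensor_coaction δ δ) Δ.
Proof.
have lt := tensor_coaction_linear.
apply: hom_ext => [||a c x xh].
- by apply: linD; exact: lin_comp.
- by apply: linD; exact: linear_tmap.
rewrite (coad_hom xh) tmap_tpure //.
apply: (comul_hom_ext (g := fun t => t ⊗ _) _ _ _ xh) => [||c1 c2 y z -> yh zh].
- exact: linD lt.
- by apply: linD; exact: linear_tpurel.
exact: tensor_coaction_hom yh zh.
Qed.

Notation β' := (bich_pull i β).

(** * Product and involution of the braided tensor square *)

Section BraidedTensor.

Let k (x y' y1 : H) (q : CΓ') (x1 : H) (p : CΓ') : H ⊗ H :=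
  bext β' q p *: (m x x1 ⊗ m y1 y').
Let kx y' y1 q x1 p : linear (fun x => k x y' y1 q x1 p).
Proof. by apply: linearZf; apply: linear_tpurel; exact: (bl _). Qed.
Let ky' x y1 q x1 p : linear (fun y' => k x y' y1 q x1 p).
Proof. by apply: linearZf; apply: linear_tpurer; exact: (br _). Qed.
Let ky1 x y' q x1 p : linear (fun y1 => k x y' y1 q x1 p).
Proof. by apply: linearZf; apply: linear_tpurer; exact: (bl _). Qed.
Let kq x y' y1 x1 p : linear (fun q => k x y' y1 q x1 p).
Proof. by apply: linear_scale; exact: (bext_bilin β').1. Qed.
Let kx1p x y' y1 q : bilin (fun x1 p => k x y' y1 q x1 p).
Proof.
apply: bilinP => w.
  by apply: linearZf; apply: linear_tpurel; exact: (br _).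
by apply: linear_scale; exact: (bext_bilin β').2.
Qed.

Let k2 x x' y' : bilin (fun y1 q => tlift (k x y' y1 q) (δ x')).
Proof. by apply: bilinP => w; apply: linear_tlift_param. Qed.

Let k3 x y : bilin (fun x' y' => tlift (fun y1 q => tlift (k x y' y1 q) (δ x')) (δ y)).
Proof.
apply: bilinP => w; apply: linear_tlift_param => y1 q; first exact: linear_tlift.
exact: linear_tlift_param.
Qed.

Let k4 t : bilin (fun x y =>
  tlift (fun x' y' => tlift (fun y1 q => tlift (k x y' y1 q) (δ x')) (δ y)) t).
Proof.
apply: bilinP => w; apply: linear_tlift_param => u v; last exact: linear_tlift.
by do 2!apply: linear_tlift_param => ? ?.
Qed.

Lemma braided_tmul_bilin : bilin (braided_tmul β' m m δ δ).
Proof.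
apply: bilinP => [t|t]; first exact: tlift_linear (k4 t).
by apply: linear_tlift_param => x y; exact: tlift_linear (k3 x y).
Qed.

Lemma braided_tmul_hom a1 c1 x a2 c2 y a1' c1' x' a2' c2' y' :
  hom a1 c1 x -> hom a2 c2 y -> hom a1' c1' x' -> hom a2' c2' y' ->
  braided_tmul β' m m δ δ (x ⊗ y) (x' ⊗ y') =
  β (i c2) (i c1') *: (m x x' ⊗ m y y').
Proof.
move=> xh yh xh' yh'; rewrite /braided_tmul (tlift_tpure _ _ (k4 _)).
rewrite (tlift_tpure _ _ (k3 _ _)) (coad_hom yh) (tlift_tpure _ _ (k2 _ _ _)).
by rewrite (coad_hom xh') (tlift_tpure _ _ (kx1p _ _ _ _)) /k bext_delta.
Qed.

(** Conjugate-linear in each of the four arguments, hence multilinear with values in the conjugate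
    module, where the lemmas on lifts apply. *)
Let j (y1 : H) (q : CΓ') (x1 : H) (p : CΓ') : cmod (H ⊗ H)%type :=
  bext β' (@hstar C CΓ' q) (@hstar C CΓ' p) *: (s x1 ⊗ s y1 : (H ⊗ H)%type).

Let aΓ : antilinear (@hstar C CΓ') := star_antilinear (hopf_star CΓ').

Let jy1 q x1 p : linear (fun y1 => j y1 q x1 p).
Proof.
move=> b u v; rewrite /j cmodE sal (linear_tpurer _ lid) scalerDr !scalerA.
by rewrite [_ * b^*]mulrC.
Qed.
Let jq y1 x1 p : linear (fun q => j y1 q x1 p).
Proof.
move=> b u v; rewrite /j cmodE aΓ.
have /= -> := (bext_bilin β').1 (@hstar C CΓ' p) b^* (hstar u) (hstar v).
by rewrite scalerDl scalerA.
Qed.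
Let jx1p y1 q : bilin (fun x1 p => j y1 q x1 p).
Proof.
apply: bilinP => w b u v; rewrite /j cmodE ?sal ?aΓ.
  by rewrite (linear_tpurel _ lid) scalerDr !scalerA [_ * b^*]mulrC.
have /= -> := (bext_bilin β').2 (@hstar C CΓ' q) b^* (hstar u) (hstar v).
by rewrite scalerDl scalerA.
Qed.

Let j2 x : bilin (fun y1 q => tlift (j y1 q) (δ x)).
Proof. by apply: bilinP => w; apply: linear_tlift_param. Qed.

Let j3 : bilin (fun x y => tlift (fun y1 q => tlift (j y1 q) (δ x)) (δ y)).
Proof.
apply: bilinP => w; last exact: linear_tlift.
by apply: linear_tlift_param => u q; exact: linear_tlift.
Qed.

Lemma braided_tstar_antilinear : antilinear (braided_tstar β' s s δ δ).
Proof. exact: tlift_linear j3. Qed.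

Lemma braided_tstar_hom a1 c1 x a2 c2 y : hom a1 c1 x -> hom a2 c2 y ->
  braided_tstar β' s s δ δ (x ⊗ y) = β (i c2) (i c1) *: (s x ⊗ s y).
Proof.
move=> xh yh; rewrite /braided_tstar [LHS](tlift_tpure _ _ j3) (coad_hom yh).
rewrite [LHS](tlift_tpure _ _ (j2 _)) (coad_hom xh) [LHS](tlift_tpure _ _ (jx1p _ _)).
have hs c : @hstar C CΓ' (gdelta c) = gdelta (- c) by exact: gstar_delta.
rewrite /j !hs bext_delta /=.
by congr (_ *: _); bichar.
Qed.

End BraidedTensor.

(** The twist of x1 with y1 is β(c1, -a'), and that of x2 with y2 is β(c2, -a' - c1') because y2 has
    left degree a' + c1'. The braiding β(c2, c1') cancels the shift, leaving β(c1 + c2, -a'), the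
    twist of x with y. *)
Lemma comulM_transm x y :
  Δ (m x y) = braided_tmul β' m m δ δ (Δ x) (Δ y).
Proof.
have [tl tr] := braided_tmul_bilin; have [ul ur] := tmul_bilin bM bM.
move: x; apply: hom_ext => [||a c x xh].
- by apply: linD; exact: (lin_comp lD (bl _)).
- by apply: linD; exact: (lin_comp (tl _) lD).
move: y; apply: hom_ext => [||a' c' y yh].
- by apply: linD; exact: (lin_comp lD (br _)).
- by apply: linD; exact: (lin_comp (tr _) lD).
rewrite (transm_mul_hom xh yh) (linZ lD) hcomulM.
apply: (comul_hom_ext (f := fun t => β (i c) (- a') *: tmul *%R *%R t (Δ y))
  (g := fun t => braided_tmul β' m m δ δ t (Δ y)) _ _ _ xh)
  => [||c1 c2 x1 x2 cE xh1 xh2].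
- by apply: linD; apply: linearZf; exact: ul.
- exact: linD (tl _).
apply: (comul_hom_ext (f := fun t => β (i c) (- a') *: tmul *%R *%R (x1 ⊗ x2) t)
  (g := braided_tmul β' m m δ δ (x1 ⊗ x2)) _ _ _ yh)
  => [||c1' c2' y1 y2 cE' yh1 yh2].
- by apply: linD; apply: linearZf; exact: ur.
- exact: linD (tr _).
rewrite tmul_tpure // (braided_tmul_hom xh1 xh2 yh1 yh2).
rewrite (transm_mul_hom xh1 yh1) (transm_mul_hom xh2 yh2).
rewrite (linZ (linear_tpurel _ lid)) (linZ (linear_tpurer _ lid)) !scalerA.
by congr (_ *: _); rewrite cE; bichar.
Qed.

(** The same cancellation within one coproduct: β(c2, c1) β(c1, -a) β(c2, -a - c1) = β(c1 + c2,
    -a). *)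
Lemma comul_star_transm x : Δ (s x) = braided_tstar β' s s δ δ (Δ x).
Proof.
have aB := braided_tstar_antilinear.
have aH := star_antilinear (hopf_star H).
have aT := tstar_antilinear aH aH.
move: x; apply: hom_ext => [u v|u v|a c x xh].
- by rewrite (antilinD sal) (linD lD).
- by rewrite (linD lD) (antilinD aB).
rewrite (transm_star_hom xh) (linZ lD) hcomul_star.
apply: (comul_hom_ext (f := fun t => _ *: tstar _ _ t) _ _ _ xh)
  => [u v||c1 c2 x1 x2 cE xh1 xh2].
- by rewrite (antilinD aT) scalerDr.
- exact: antilinD aB.
rewrite tstar_tpure // (braided_tstar_hom xh1 xh2).
rewrite (transm_star_hom xh1) (transm_star_hom xh2).
rewrite (linZ (linear_tpurel _ lid)) (linZ (linear_tpurer _ lid)) !scalerA.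
by congr (_ *: _); rewrite cE; bichar.
Qed.

(** * Counit and antipode *)

Lemma counit_comodule : is_comodule_map δ (@trivial_coaction C Γ') (ε : H -> C^o).
Proof.
apply: hom_ext => [||a c x xh].
- by apply: linD; exact: linear_tpurel.
- by apply: linD; exact: linear_tmap.
rewrite (coad_hom xh) tmap_tpure // /trivial_coaction.
have [-> //|c0] := eqVneq c 0; rewrite (counit_hom xh c0).
by rewrite !(lin0 (linear_tpurel _ (@linear_id _ C^o))).
Qed.

Lemma counitM_transm x y : ε (m x y) = ε x * ε y.
Proof.
have eD := linD le.
move: x; apply: hom_ext => [u v|u v|a c x xh].
- by rewrite (linD (bl _)) eD.
- by rewrite eD mulrDl.
move: y; apply: hom_ext => [u v|u v|a' c' y yh].
- by rewrite (linD (br _)) eD.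
- by rewrite eD mulrDr.
rewrite (transm_mul_hom xh yh) (linZ le) hcounitM.
have [c0|c0] := eqVneq c 0; first by rewrite c0 raddf0 bichar0l scale1r.
by rewrite (counit_hom xh c0) mul0r scaler0.
Qed.

Lemma counit_star_transm x : ε (s x) = (ε x)^*.
Proof.
have eD := linD le.
move: x; apply: hom_ext => [u v|u v|a c x xh].
- by rewrite (antilinD sal) eD.
- by rewrite eD rmorphD.
rewrite (transm_star_hom xh) (linZ le) hcounit_star.
have [c0|c0] := eqVneq c 0; first by rewrite c0 raddf0 bichar0l scale1r.
by rewrite (counit_hom xh c0) conjC0 scaler0.
Qed.

Lemma antip_comodule : is_comodule_map δ δ S.
Proof.
apply: hom_ext => [||a c x xh].
- by apply: linD; exact: (lin_comp lδ lS).
- by apply: linD; exact: linear_tmap.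
rewrite (coad_hom xh) tmap_tpure // (transm_antip_hom xh) (linZ lδ).
by rewrite (coad_hom (hom_antip xh)) (linZ (linear_tpurel _ lid)).
Qed.

Lemma transm_antipode : is_antipode 1 m Δ ε S.
Proof.
have lS0 : linear (@hantip C H) := antip_linear (hopf_antip H).
split=> [//|x|x].
- have b0 : bilin (fun y z : H => hantip y * z).
    by apply: bilinP => u; [exact: linear_mulrl|exact: linear_mulrr].
  have b1 : bilin (fun y z : H => m (S y) z).
    by apply: bilinP => u; [exact: (lin_comp (bl _))|exact: (br _)].
  move: x; apply: hom_ext => [||a c x xh].
  + by apply: linD; exact: linear_tlift.
  + by apply: linD; exact: linear_scale.
  rewrite -(antipl (hopf_antip H)).
  apply: (comul_hom_ext (f := fun t => tlift _ t) (g := fun t => tlift _ t) _ _ _ xh)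
    => [||c1 c2 y z _ yh zh].
  + by apply: linD; exact: tlift_linear.
  + by apply: linD; exact: tlift_linear.
  rewrite !tlift_tpure // (transm_antip_hom yh) (linZ (bl _)).
  (* The factor β(c1, a + c1) in the twisted antipode is the inverse of the product twist β(c1, -(a
     + c1)), so this side reduces to the untwisted axiom term by term. *)
  rewrite (transm_mul_hom (hom_antip yh) zh) scalerA -[RHS]scale1r.
  by congr (_ *: _); bichar.
- have b0 : bilin (fun y z : H => y * hantip z).
    by apply: bilinP => u; [exact: linear_mulrl|exact: linear_mulrr].
  have b1 : bilin (fun y z : H => m y (S z)).
    by apply: bilinP => u; [exact: (bl _)|exact: (lin_comp (br _))].
  move: x; apply: hom_ext => [||a c x xh].
  + by apply: linD; exact: linear_tlift.
  + by apply: linD; exact: linear_scale.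
  (* Here the twists do not cancel: β(c2, a + c) from the antipode and β(c1, a + c) from the product
     combine to β(c, a + c). This is independent of the splitting of c, so it comes out of the sum,
     and it is 1 in degree 0, the only degree where ε is nonzero. *)
  transitivity (β (i c) (a + i c) *: tlift (fun y z : H => y * hantip z) (Δ x)).
    apply: (comul_hom_ext (f := fun t => tlift _ t) (g := fun t => _ *: tlift _ t)
      _ _ _ xh) => [||c1 c2 y z cE yh zh].
    * by apply: linD; exact: tlift_linear.
    * by apply: linD; apply: linearZf; exact: tlift_linear.
    rewrite !tlift_tpure // (transm_antip_hom zh) (linZ (br _)).
    rewrite (transm_mul_hom yh (hom_antip zh)) scalerA cE.
    by congr (_ *: _); bichar.
  rewrite (antipr (hopf_antip H)).
  have [c0|c0] := eqVneq c 0; first by rewrite c0 raddf0 bichar0l scale1r.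
  by rewrite (counit_hom xh c0) !scale0r scaler0.
Qed.

Lemma transmutation_braided_hopf_star :
  is_braided_hopf_star β' (with_coaction (transmutation π β) δ).
Proof.
split.
- exact: transm_comodule_star_algebra.
- exact: coH.
- exact: comul_comodule.
- exact: hcomul1.
- exact: comulM_transm.
- exact: comul_star_transm.
- exact: counit_comodule.
- exact: hcounit1.
- exact: counitM_transm.
- exact: counit_star_transm.
- exact: antip_comodule.
- exact: transm_antipode.
Qed.

End CocentralTransmutation.

Theorem proposition2p4 (R : realType) (T : topologicalZmodType)
    (T_compact : compact [set: T]) (T_hausdorff : hausdorff_space T)
    (H : hopfStarAlg R[i]) (π : hopfStarMap H (group_hopf R[i] (dual R[i] T)))
    (β : bicharacter R[i] (dual R[i] T))
    (T0 : set T) (T0_closed_subgroup : closed_subgroup T0)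
    (T0_cocentral : cocentral π T0) :
  exists δ : H -> H ⊗ group_hopf R[i] (ann R[i] T0),
    (forall x : H, tmap id (gmap (ann_incl R[i] T0)) (δ x) = ad π x) /\
    is_braided_hopf_star (bich_pull (ann_incl R[i] T0) β)
      (with_coaction (transmutation π β) δ).
Proof.
have i_inj : injective (ann_incl R[i] T0) by exact: val_inj.
have deg_i (a b : dual R[i] T) (x : H) : bigraded π a b x -> x != 0 ->
    exists c, ann_incl R[i] T0 c = b - a.
  move=> xab x0; suff abP : b - a \in @ann_pred R[i] T T0 by exists (Ann abP).
  apply/asboolP => t T0t.
  have ab : forall t, T0 t -> a t = b t.
    by apply: contrapT => ab; case/eqP: x0; exact: T0_cocentral ab x xab.
  have [_ _ _ T0N] := T0_closed_subgroup.
  (* [(b - a) t] unfolds to [b t * a (- t)], so the agreement of [a] and [b] on [T0] is used at the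
     point [- t]. *)
  transitivity (b t * b (- t)); first by rewrite -(ab _ (T0N _ T0t)).
  by rewrite -(charD b) subrr char0.
exists (coad (ann_incl R[i] T0) π); split=> [x|].
  exact: tmap_gmap_coad.
exact: transmutation_braided_hopf_star.
Qed.
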